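(* Let $K$ be a field, $n\ge3$, let $Q=\vec A_n$ be the linearly oriented quiver $1\to2\to\cdots\to n$, let $R$ be a set of zero relations on $Q$ such that $1$ is the source of a relation in $R$ and $n$ is the target of a relation in $R$, and let $A=KQ/\langle R\rangle$. Let $R_0^s$ and $R_0^t$ denote respectively the set of sources and the set of targets of the relations in $R$. (i) If there is a vertex $a\in Q_0$ having an immediate successor $a^+$ such that $a\notin R_0^s$ and $a^+\notin R_0^t$, then $\mathrm{dom.dim}\,A=1$. (ii) If $Q_0$ contains a free vertex, then $\mathrm{dom.dim}\,A\le 2$.
   Context: A zero relation is a single path of length at least two which is set to zero; zero relations are taken to be minimal. The source (target) of a zero relation is the source of its first arrow (target of its last arrow). A vertex is free if it is neither the source nor the target of any zero relation in $R$. For $a\in Q_0$, $a^+$ denotes its immediate successor. Modules are finite dimensional left modules. For a module $M$ and $k\ge 1$, $\mathrm{dom.dim}\,M\ge k$ means that in a minimal injective resolution $0\to M\to I_1\to I_2\to\cdots$ the modules $I_1,\dots,I_k$ are projective (zero counts as projective); $\mathrm{dom.dim}\,M=0$ if $I_1$ is not projective; $\mathrm{dom.dim}\,M=k$ if $\ge k$ but not $\ge k+1$; otherwise $\infty$. $\mathrm{dom.dim}\,A:=\mathrm{dom.dim}({}_AA)$. *)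

(* Defs.v *)
From HB Require Import structures.
From mathcomp Require Import all_boot all_algebra.
From mathcomp Require Import boolp.

Set Implicit Arguments.
Unset Strict Implicit.
Unset Printing Implicit Defensive.

Import GRing.Theory.
Local Open Scope ring_scope.
Local Open Scope quotient_scope.

(* The vertices of 1 -> 2 -> ... -> n are the elements of 'I_n, so the vertex
   called 1 is the ordinal 0.  In this quiver a path is determined by its
   endpoints, and there is one from i to j exactly when i <= j; (i, i) is the
   trivial path at i. *)
Definition qpath (n : nat) := {p : 'I_n * 'I_n | (p.1 <= p.2)%N}.

Section Paths.
Variable n : nat.
Implicit Types p q r : qpath n.

Definition src p : 'I_n := (val p).1.
Definition tgt p : 'I_n := (val p).2.
Definition plength p : nat := (tgt p - src p)%N.

Lemma src_le_tgt p : (src p <= tgt p)%N. Proof. exact: valP p. Qed.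

Lemma trivial_pathP (i : 'I_n) : ((i, i).1 <= (i, i).2)%N.
Proof. exact: leqnn. Qed.

Definition trivial_path (i : 'I_n) : qpath n := Sub (i, i) (trivial_pathP i).

Definition subpath p q := (src q <= src p)%N && (tgt p <= tgt q)%N.

(* Paths compose from right to left: [pcomp q p r] says that r runs through p,
   then through q. *)
Definition pcomp q p r := [&& tgt p == src q, src r == src p & tgt r == tgt q].

Lemma qpathP p q : src p = src q -> tgt p = tgt q -> p = q.
Proof.
move: p q => [[i j] p] [[i' j'] q]; rewrite /src /tgt /= => ei ej.
by apply: val_inj; rewrite /= ei ej.
Qed.

Lemma pcompP q p r :
  reflect [/\ tgt p = src q, src p = src r & tgt q = tgt r] (pcomp q p r).
Proof.
by apply: (iffP and3P) => [[/eqP-> /eqP-> /eqP->]|[-> -> ->]].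
Qed.

End Paths.

Record zero_relations (n : nat) := ZeroRelations {
  zrel_set :> {set qpath n};
  zrel_length : forall r, r \in zrel_set -> (2 <= plength r)%N;
  zrel_minimal : forall r s,
    r \in zrel_set -> s \in zrel_set -> subpath r s -> r = s
}.

Section Vertices.
Variables (n : nat) (R : zero_relations n).

Definition sources : {set 'I_n} := [set src r | r in zrel_set R].
Definition targets : {set 'I_n} := [set tgt r | r in zrel_set R].

Definition free_vertex (a : 'I_n) := (a \notin sources) && (a \notin targets).

Definition is_immediate_succ (a b : 'I_n) := b == a.+1 :> nat.

End Vertices.

(* The vector space with basis the paths.  {ffun _ -> _} also carries a pointwise
   product; the ring structure put on [path_algebra K n.+1] below is [pa_mul]. *)
Definition path_algebra (K : fieldType) (n : nat) := {ffun qpath n -> K^o}.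

HB.instance Definition _ (K : fieldType) n :=
  GRing.Lmodule.on (path_algebra K n).

Section PathAlgebra.
Variables (K : fieldType) (n : nat).
Local Notation KQ := (path_algebra K n).
Implicit Types x y z : KQ.

Definition path_elt (p : qpath n) : KQ := [ffun q => (q == p)%:R].

Definition pa_one : KQ := \sum_(i < n) path_elt (trivial_path i).

Definition pa_mul x y : KQ :=
  [ffun p => \sum_q \sum_(r | pcomp q r p) x q * y r].

Lemma pa_oneE p : pa_one p = (src p == tgt p)%:R.
Proof.
rewrite /pa_one sum_ffunE (bigD1 (src p)) //= big1 ?addr0.
  rewrite ffunE; congr (_ %:R); congr nat_of_bool.
  apply/eqP/eqP => [-> //|e]; exact: qpathP.
move=> i ne; rewrite ffunE; case: eqP => // e.
by rewrite e eqxx in ne.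
Qed.

Lemma pa_mulA : associative pa_mul.
Proof.
move=> x y z; apply/ffunP => p; rewrite !ffunE.
transitivity (\sum_q \sum_s \sum_t \sum_r
   if (pcomp q r p) && (pcomp s t r)
   then x q * y s * z t else 0).
  apply: eq_bigr => q _.
  transitivity (\sum_r \sum_s \sum_t
    if (pcomp q r p) && (pcomp s t r)
    then x q * y s * z t else 0).
    rewrite big_mkcond; apply: eq_bigr => r _.
    case: ifP => [qr|_] /=; last by rewrite big1 // => s _; rewrite big1.
    rewrite ffunE mulr_sumr; apply: eq_bigr => s _.
    rewrite mulr_sumr big_mkcond; apply: eq_bigr => t _.
    by rewrite mulrA.
  rewrite exchange_big; apply: eq_bigr => s _.
  by rewrite exchange_big.
transitivity (\sum_q \sum_s \sum_t \sum_r
   if (pcomp r t p) && (pcomp q s r)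
   then x q * y s * z t else 0); last first.
  under eq_bigr => q _ do under eq_bigr => s _ do rewrite exchange_big.
  under eq_bigr => q _ do rewrite exchange_big.
  rewrite exchange_big; apply: eq_bigr => r _.
  under eq_bigr => q _ do rewrite exchange_big.
  rewrite exchange_big [RHS]big_mkcond; apply: eq_bigr => t _.
  case: ifP => [rt|_] /=; last by rewrite big1 // => q _; rewrite big1.
  rewrite ffunE mulr_suml; apply: eq_bigr => q _.
  by rewrite mulr_suml [RHS]big_mkcond; apply: eq_bigr => s _.
apply: eq_bigr => q _; apply: eq_bigr => s _; apply: eq_bigr => t _.
have half (P : pred (qpath n)) (v : K) :
    (forall r r', P r -> P r' -> r = r') ->
    \sum_r (if P r then v else 0) = if [exists r, P r] then v else 0.
  move=> uP; case: existsP => [[r Pr]|nP].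
    rewrite (bigD1 r) //= Pr big1 ?addr0 // => r' ne; case: ifP => // Pr'.
    by rewrite (uP _ _ Pr Pr') eqxx in ne.
  by rewrite big1 // => r _; case: ifP => // Pr; case: nP; exists r.
rewrite !half.
- congr (if _ then _ else _); apply/existsP/existsP => -[r].
    case/andP => /pcompP[e1 e2 e3] /pcompP[f1 f2 f3].
    have le : ((src s, tgt q).1 <= (src s, tgt q).2)%N.
      by rewrite /= (leq_trans (src_le_tgt s)) // f3 e1 src_le_tgt.
    exists (Sub (src s, tgt q) le); apply/andP.
    by split; apply/pcompP; split; rewrite /src /tgt //= -/(src _) -/(tgt _)
      ?f2 ?e2 ?f3 ?e1.
  case/andP => /pcompP[e1 e2 e3] /pcompP[f1 f2 f3].
  have le : ((src t, tgt s).1 <= (src t, tgt s).2)%N.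
    by rewrite /= (leq_trans (src_le_tgt t)) // e1 -f2 src_le_tgt.
  exists (Sub (src t, tgt s) le); apply/andP.
  by split; apply/pcompP; split; rewrite /src /tgt //= -/(src _) -/(tgt _)
    ?f2 ?e2 ?f3 ?e1.
- by move=> r r' /andP[_ /pcompP[_ e1 e2]] /andP[_ /pcompP[_ f1 f2]];
    apply: qpathP; rewrite -?e1 -?e2.
- by move=> r r' /andP[_ /pcompP[_ e1 e2]] /andP[_ /pcompP[_ f1 f2]];
    apply: qpathP; rewrite -?e1 -?e2.
Qed.

Lemma pa_mul1l : left_id pa_one pa_mul.
Proof.
move=> x; apply/ffunP => p; rewrite ffunE.
rewrite (bigD1 (trivial_path (tgt p))) //= [X in _ + X]big1 ?addr0.
  rewrite (bigD1 p) /=; last by apply/pcompP; split.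
  rewrite pa_oneE eqxx mul1r big1 ?addr0 // => r /andP[/pcompP[e1 e2 _]].
  by rewrite (qpathP e2 e1) eqxx.
move=> q ne; rewrite big1 // => r /pcompP[_ _ e]; rewrite pa_oneE.
case: eqP => [e'|_]; last by rewrite mul0r.
by case/eqP: ne; apply: qpathP => //=; rewrite e' e.
Qed.

Lemma pa_mul1r : right_id pa_one pa_mul.
Proof.
move=> x; apply/ffunP => p; rewrite ffunE.
rewrite (bigD1 p) //= [X in _ + X]big1 ?addr0.
  rewrite (bigD1 (trivial_path (src p))) /=; last by apply/pcompP; split.
  rewrite pa_oneE eqxx mulr1 big1 ?addr0 // => r /andP[/pcompP[e1 e2 _]].
  by rewrite (@qpathP _ r (trivial_path (src p))) ?eqxx.
move=> q ne; rewrite big1 // => r /pcompP[e1 e2 e3]; rewrite pa_oneE.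
case: eqP => [e|_]; last by rewrite mulr0.
by case/eqP: ne; apply: qpathP => //; rewrite -e1 -e.
Qed.

Lemma pa_mulDl : left_distributive pa_mul +%R.
Proof.
move=> x y z; apply/ffunP => p; rewrite !ffunE -big_split /=.
apply: eq_bigr => q _; rewrite -big_split; apply: eq_bigr => r _.
by rewrite ffunE mulrDl.
Qed.

Lemma pa_mulDr : right_distributive pa_mul +%R.
Proof.
move=> x y z; apply/ffunP => p; rewrite !ffunE -big_split /=.
apply: eq_bigr => q _; rewrite -big_split; apply: eq_bigr => r _.
by rewrite ffunE mulrDr.
Qed.

Lemma pa_scaleAl (a : K) x y : a *: pa_mul x y = pa_mul (a *: x) y.
Proof.
apply/ffunP => p; rewrite !ffunE scaler_sumr; apply: eq_bigr => q _.
by rewrite scaler_sumr; apply: eq_bigr => r _; rewrite !ffunE scalerAl.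
Qed.

Lemma pa_scaleAr (a : K) x y : a *: pa_mul x y = pa_mul x (a *: y).
Proof.
apply/ffunP => p; rewrite !ffunE scaler_sumr; apply: eq_bigr => q _.
by rewrite scaler_sumr; apply: eq_bigr => r _; rewrite !ffunE scalerAr.
Qed.

End PathAlgebra.

(* The quiver must have a vertex for the ring to be non trivial. *)
Section NonTrivialPathAlgebra.
Variables (K : fieldType) (n : nat).
Local Notation KQ := (path_algebra K n.+1).

Lemma pa_one_neq0 : pa_one K n.+1 != 0.
Proof.
apply/eqP => /ffunP /(_ (trivial_path ord0)).
by rewrite pa_oneE eqxx ffunE => /eqP; rewrite oner_eq0.
Qed.

HB.instance Definition _ := GRing.Zmodule_isNzRing.Build KQ
  (@pa_mulA K n.+1) (@pa_mul1l K n.+1) (@pa_mul1r K n.+1)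
  (@pa_mulDl K n.+1) (@pa_mulDr K n.+1) pa_one_neq0.

HB.instance Definition _ := GRing.Lmodule_isLalgebra.Build K KQ
  (@pa_scaleAl K n.+1).

HB.instance Definition _ := GRing.Lalgebra_isAlgebra.Build K KQ
  (@pa_scaleAr K n.+1).

End NonTrivialPathAlgebra.

Definition gen_ideal (B : nzRingType) (S : B -> Prop) (x : B) : Prop :=
  exists s : seq (B * B * B),
    (forall t, t \in s -> S t.1.2) /\ x = \sum_(t <- s) t.1.1 * t.1.2 * t.2.

Section GeneratedIdeal.
Variables (B : nzRingType) (S : B -> Prop).

Lemma gen_ideal0 : gen_ideal S 0.
Proof. by exists [::]; split=> //; rewrite big_nil. Qed.

Lemma gen_idealD x y : gen_ideal S x -> gen_ideal S y -> gen_ideal S (x + y).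
Proof.
move=> [s [Ss ->]] [t [St ->]]; exists (s ++ t); split; last by rewrite big_cat.
by move=> u; rewrite mem_cat => /orP[/Ss|/St].
Qed.

Lemma gen_idealMl a x : gen_ideal S x -> gen_ideal S (a * x).
Proof.
move=> [s [Ss ->]]; exists [seq (a * t.1.1, t.1.2, t.2) | t <- s].
split; first by move=> _ /mapP[t /Ss St ->].
by rewrite big_map mulr_sumr; apply: eq_bigr => t _; rewrite /= !mulrA.
Qed.

Lemma gen_idealMr a x : gen_ideal S x -> gen_ideal S (x * a).
Proof.
move=> [s [Ss ->]]; exists [seq (t.1.1, t.1.2, t.2 * a) | t <- s].
split; first by move=> _ /mapP[t /Ss St ->].
by rewrite big_map mulr_suml; apply: eq_bigr => t _; rewrite /= !mulrA.
Qed.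

End GeneratedIdeal.

Section BoundPathAlgebra.
Variables (K : fieldType) (n : nat) (R : zero_relations n.+1).
Local Notation KQ := (path_algebra K n.+1).

Definition rel_ideal : {pred KQ} :=
  fun x => `[< gen_ideal
                 (fun y => exists2 r, r \in zrel_set R & y = path_elt K r) x >].

Lemma rel_idealMl (a x : KQ) : x \in rel_ideal -> a * x \in rel_ideal.
Proof. by move=> /asboolP h; apply/asboolP/gen_idealMl. Qed.

Lemma rel_idealMr (a x : KQ) : x \in rel_ideal -> x * a \in rel_ideal.
Proof. by move=> /asboolP h; apply/asboolP/gen_idealMr. Qed.

Lemma rel_ideal_trivial_path (x : KQ) i :
  x \in rel_ideal -> x (trivial_path i) = 0.
Proof.
move=> /asboolP[s [Rs ->]]; rewrite sum_ffunE big_seq big1 // => t /Rs[r rR ->].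
have r2 := zrel_length rR.
rewrite ffunE big1 // => q _; rewrite big1 // => u /pcompP[e1 e2 e3].
rewrite ffunE big1 ?mul0r // => v _; rewrite big1 // => w /pcompP[f1 f2 f3].
rewrite ffunE; case: eqP => [ew|_]; last by rewrite mulr0.
suff : (tgt w <= src w)%N.
  by rewrite -subn_eq0 -/(plength w) ew; case: plength r2.
rewrite f1 f2 -e1 (leq_trans (src_le_tgt v)) // f3 e3.
by rewrite (leq_trans _ (src_le_tgt u)) // e2.
Qed.

Lemma rel_ideal_closed : idealr_closed rel_ideal.
Proof.
split; first exact/asboolP/gen_ideal0.
  apply/negP => /(rel_ideal_trivial_path ord0)/eqP.
  by rewrite pa_oneE eqxx oner_eq0.
move=> a u v uI /asboolP vI; apply/asboolP/gen_idealD => //.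
exact/asboolP/rel_idealMl.
Qed.

HB.instance Definition _ := isIdealr.Build KQ rel_ideal rel_ideal_closed.

Definition bound_path_algebra := Quotient.quot rel_ideal.

Local Notation A := bound_path_algebra.

HB.instance Definition _ := GRing.Zmodule.on A.

Definition bpa_proj (x : KQ) : A := \pi_(Quotient.quot rel_ideal) x.
Definition bpa_repr (a : A) : KQ := repr (a : Quotient.quot rel_ideal).

Definition bpa_mul (a b : A) : A := bpa_proj (bpa_repr a * bpa_repr b).
Definition bpa_scale (k : K) (a : A) : A := bpa_proj (k *: bpa_repr a).

Lemma bpa_reprK : cancel bpa_repr bpa_proj. Proof. exact: reprK. Qed.

Lemma bpa_eqP (x y : KQ) :
  reflect (bpa_proj x = bpa_proj y) (x - y \in rel_ideal).
Proof.
by rewrite Quotient.idealrBE; exact: (@eqP (Quotient.quot rel_ideal)).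
Qed.

Lemma bpa_projB_closed : zmod_morphism bpa_proj.
Proof. by move=> x y; rewrite /bpa_proj raddfB. Qed.

HB.instance Definition _ :=
  GRing.isZmodMorphism.Build KQ A bpa_proj bpa_projB_closed.

Lemma repr_piB (x : KQ) : bpa_repr (bpa_proj x) - x \in rel_ideal.
Proof. by apply/bpa_eqP; rewrite bpa_reprK. Qed.

Lemma bpa_piM (x y : KQ) : bpa_mul (bpa_proj x) (bpa_proj y) = bpa_proj (x * y).
Proof.
apply/bpa_eqP; set x' := bpa_repr _; set y' := bpa_repr _.
have -> : x' * y' - x * y = (x' - x) * y' + x * (y' - y).
  by rewrite mulrBl mulrBr addrA subrK.
apply: rpredD; first exact/rel_idealMr/repr_piB.
exact/rel_idealMl/repr_piB.
Qed.

Lemma bpa_piZ (k : K) (x : KQ) : bpa_scale k (bpa_proj x) = bpa_proj (k *: x).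
Proof.
apply/bpa_eqP; rewrite -scalerBr -[_ - _]mul1r scalerAl.
exact/rel_idealMl/repr_piB.
Qed.

Lemma bpa_piD (x y : KQ) : bpa_proj x + bpa_proj y = bpa_proj (x + y).
Proof. by rewrite [RHS]raddfD. Qed.

Lemma bpa_mulA : associative bpa_mul.
Proof.
by move=> a b c; rewrite -[a]bpa_reprK -[b]bpa_reprK -[c]bpa_reprK !bpa_piM mulrA.
Qed.

Lemma bpa_mul1l : left_id (bpa_proj 1) bpa_mul.
Proof. by move=> a; rewrite -[a]bpa_reprK bpa_piM mul1r. Qed.

Lemma bpa_mul1r : right_id (bpa_proj 1) bpa_mul.
Proof. by move=> a; rewrite -[a]bpa_reprK bpa_piM mulr1. Qed.

Lemma bpa_mulDl : left_distributive bpa_mul +%R.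
Proof.
move=> a b c; rewrite -[a]bpa_reprK -[b]bpa_reprK -[c]bpa_reprK.
by rewrite !(bpa_piM, bpa_piD) mulrDl.
Qed.

Lemma bpa_mulDr : right_distributive bpa_mul +%R.
Proof.
move=> a b c; rewrite -[a]bpa_reprK -[b]bpa_reprK -[c]bpa_reprK.
by rewrite !(bpa_piM, bpa_piD) mulrDr.
Qed.

Lemma bpa_one_neq0 : bpa_proj 1 != 0.
Proof.
rewrite -[0](raddf0 bpa_proj); apply/eqP => /bpa_eqP; rewrite subr0.
by case: rel_ideal_closed => _ /negP.
Qed.

HB.instance Definition _ := GRing.Zmodule_isNzRing.Build A
  bpa_mulA bpa_mul1l bpa_mul1r bpa_mulDl bpa_mulDr bpa_one_neq0.

Lemma bpa_scaleA (k l : K) (a : A) :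
  bpa_scale k (bpa_scale l a) = bpa_scale (k * l) a.
Proof. by rewrite -[a]bpa_reprK !bpa_piZ scalerA. Qed.

Lemma bpa_scale1 : left_id 1 bpa_scale.
Proof. by move=> a; rewrite -[a]bpa_reprK bpa_piZ scale1r. Qed.

Lemma bpa_scaleDr : right_distributive bpa_scale +%R.
Proof.
move=> k a b; rewrite -[a]bpa_reprK -[b]bpa_reprK.
by rewrite !(bpa_piZ, bpa_piD) scalerDr.
Qed.

Lemma bpa_scaleDl (a : A) : {morph bpa_scale^~ a : k l / k + l}.
Proof.
by move=> k l; rewrite -[a]bpa_reprK !(bpa_piZ, bpa_piD) scalerDl.
Qed.

HB.instance Definition _ := GRing.Zmodule_isLmodule.Build K A
  bpa_scaleA bpa_scale1 bpa_scaleDr bpa_scaleDl.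

Lemma bpa_scaleAl (k : K) (a b : A) : k *: (a * b) = (k *: a) * b.
Proof.
rewrite -[a]bpa_reprK -[b]bpa_reprK.
by rewrite /GRing.scale /GRing.mul /= !(bpa_piM, bpa_piZ) scalerAl.
Qed.

Lemma bpa_scaleAr (k : K) (a b : A) : k *: (a * b) = a * (k *: b).
Proof.
rewrite -[a]bpa_reprK -[b]bpa_reprK.
by rewrite /GRing.scale /GRing.mul /= !(bpa_piM, bpa_piZ) scalerAr.
Qed.

HB.instance Definition _ := GRing.Lmodule_isLalgebra.Build K A bpa_scaleAl.
HB.instance Definition _ := GRing.Lalgebra_isAlgebra.Build K A bpa_scaleAr.

Lemma bpa_proj_monoid_morphism : monoid_morphism bpa_proj.
Proof. by split=> // x y; exact: esym (bpa_piM x y). Qed.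

HB.instance Definition _ :=
  GRing.isMonoidMorphism.Build KQ A bpa_proj bpa_proj_monoid_morphism.

Lemma bpa_proj_scalable : scalable bpa_proj.
Proof. by move=> k x; exact: esym (bpa_piZ k x). Qed.

HB.instance Definition _ :=
  GRing.isScalable.Build K KQ A *:%R bpa_proj bpa_proj_scalable.

End BoundPathAlgebra.

Section DominantDimension.
Variables (K : fieldType) (A : algType K).

(* The field K acts on an A-module through k |-> k%:A. *)
Definition fin_dim (M : lmodType A) : Prop :=
  exists s : seq M, forall x : M, exists c : 'I_(size s) -> K,
    x = \sum_(i < size s) (c i)%:A *: s`_i.

Definition injective_module (I : lmodType A) : Prop :=
  forall (X Y : lmodType A), fin_dim X -> fin_dim Y ->
  forall (f : {linear X -> Y}) (g : {linear X -> I}), injective f ->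
  exists h : {linear Y -> I}, forall x, h (f x) = g x.

Definition projective_module (P : lmodType A) : Prop :=
  forall (X Y : lmodType A), fin_dim X -> fin_dim Y ->
  forall (f : {linear X -> Y}) (g : {linear P -> Y}),
    (forall y, exists x, f x = y) ->
  exists h : {linear P -> X}, forall p, f (h p) = g p.

Definition essential_image (X Y : lmodType A) (f : X -> Y) : Prop :=
  forall U : {pred Y}, submod_closed U ->
    (exists2 u, u \in U & u != 0) ->
  exists2 x, f x \in U & f x != 0.

(* [res_term k] is the term I_(k+1) of 0 -> M -> I_1 -> I_2 -> ...; minimality
   means that each term is an injective hull of the image of the map into it. *)
Record min_inj_resolution (M : lmodType A) := MinInjResolution {
  res_term : nat -> lmodType A;
  res_aug : {linear M -> res_term 0};
  res_diff : forall k, {linear res_term k -> res_term k.+1};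
  res_fin_dim : forall k, fin_dim (res_term k);
  res_injective : forall k, injective_module (res_term k);
  res_aug_inj : injective res_aug;
  res_exact0 : forall x, res_diff 0 x = 0 <-> exists m, res_aug m = x;
  res_exact : forall k x,
    res_diff k.+1 x = 0 <-> exists y, res_diff k y = x;
  res_minimal0 : essential_image res_aug;
  res_minimal : forall k, essential_image (res_diff k)
}.

Definition dom_dim_ge (M : lmodType A) (k : nat) : Prop :=
  exists E : min_inj_resolution M,
    forall i, (i < k)%N -> projective_module (res_term E i).

Definition dom_dim_eq (M : lmodType A) (k : nat) : Prop :=
  dom_dim_ge M k /\ ~ dom_dim_ge M k.+1.

Definition dom_dim_le (M : lmodType A) (k : nat) : Prop :=
  exists2 d, (d <= k)%N & dom_dim_eq M d.

End DominantDimension.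

(* Main.v *)
Require Import Defs.
From HB Require Import structures.
From mathcomp Require Import all_boot all_algebra boolp zify.

(** The algebra A is a Nakayama algebra. The path from u to v is nonzero in A
exactly when it contains no relation, that is when cutoff (v + 1) <= u <= v. The
modules that matter are interval modules: on the interval from c to h - 1, all of
whose paths are nonzero, each path acts as 1 from its source to its target. Such a
module is projective when the interval cannot be prolonged at its end, and
injective when it cannot be prolonged at its beginning, that is when c = cutoff h
([intervals_injective]).

The projective P_i at a vertex i is the interval from i to p, the last vertex
that i reaches. Its injective hull is the interval from cutoff (p + 1) to p. Its
cokernel and all further cosyzygies are again intervals, so the minimal injective
resolution of A can be written down ([regular_resolution]). The first term is
projective, since the interval from cutoff (p + 1) to p cannot be prolonged to
p + 1 when the one from i to p cannot ([hull0_projective]). Hence the dominant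
dimension is at least 1.

The upper bounds hold for any minimal injective resolution, and are proved by
following a vector at a vertex b that is killed by the arrow b -> b + 1. In a
projective module such a vector must be 0 when b + 1 is not a target, because a
finite dimensional projective module embeds in a free one, where only the
completion of a relation can kill a path ([projective_arrow_injective]).
Conversely, injectivity provides vectors: if a <= b are two tops of intervals with
the same end, every vector at b that is killed by the paths going beyond this end is
a multiple of a vector at a ([injective_divisible]).

Suppose that a is not a source. Then P_(a+1) embeds in P_a, so in the first term
the generator of P_(a+1) is the multiple of some y at a. The class of y modulo A
is nonzero and killed by the arrow a -> a + 1, so the second term is not
projective when a + 1 is not a target ([second_term_not_projective]). Suppose now
that a is free. If a - 1 is not a source, the pair (a - 1, a) is of the kind just
treated. If a - 1 is a source, the class of y is the multiple of some z at a - 1,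
whose image in the third term is nonzero and killed by the arrow a - 1 -> a; as a
is not a target, the third term is not projective
([third_term_not_projective]). *)

Set Implicit Arguments.
Unset Strict Implicit.
Unset Printing Implicit Defensive.

Import GRing.Theory.
Local Open Scope ring_scope.

(** * Finite dimensional modules over an algebra *)

Definition linear_map (A : nzRingType) (X Y : lmodType A) (f : X -> Y)
    (fL : linear f) : {linear X -> Y} :=
  HB.pack f (GRing.isLinear.Build A X Y *:%R f fL).

Section ModuleTheory.
Variables (K : fieldType) (A : algType K).

Lemma fin_dim_family (M : lmodType A) (T : finType) (e : T -> M) :
  (forall x, exists c : T -> K, x = \sum_t (c t)%:A *: e t) -> fin_dim M.
Proof.
move=> sp; exists [seq e t | t <- enum T] => x; have [c ->] := sp x.
have sz : size [seq e t | t <- enum T] = #|T| by rewrite size_map -cardE.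
exists (fun i => c (enum_val (cast_ord sz i))).
rewrite (reindex (fun i => enum_val (cast_ord sz i))) /=; last first.
  exists (fun t => cast_ord (esym sz) (enum_rank t)) => [i|t] _.
    by rewrite enum_valK cast_ordK.
  by rewrite cast_ordKV enum_rankK.
apply: eq_bigr => i _; congr (_ *: _).
have iT : (i < size (enum T))%N by rewrite -cardE -sz.
by rewrite (nth_map (enum_val (cast_ord sz i))) //= /enum_val; congr e;
  apply: set_nth_default.
Qed.

Lemma fin_dim_ffun (J : finType) (M : lmodType A) :
  fin_dim M -> fin_dim {ffun J -> M}.
Proof.
move=> [s sp].
apply: (@fin_dim_family _ (J * 'I_(size s))%type
  (fun t => [ffun j => if j == t.1 then s`_t.2 else 0])) => x.
have [c cE] := choice (fun j => sp (x j)).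
exists (fun t => c t.1 t.2); apply/ffunP => j; rewrite sum_ffunE cE.
rewrite -(pair_bigA _ (fun j' i =>
  ((c j' i)%:A *: [ffun j0 => if j0 == j' then s`_i else 0]) j)) /=.
rewrite (bigD1 j) //= [X in _ + X]big1 ?addr0.
  by apply: eq_bigr => i _; rewrite !ffunE eqxx.
move=> j' ne; rewrite big1 // => i _; rewrite !ffunE.
by rewrite eq_sym (negPf ne) scaler0.
Qed.

(** Half of the dual basis lemma: a lift is forced on the elements [e t] by
choosing preimages, and the coordinate maps [c t] extend the choice linearly. *)
Lemma projective_of_dual_basis (P : lmodType A) (T : finType)
    (c : T -> {linear P -> A^o}) (e : T -> P) :
  (forall z, z = \sum_t (c t z : A) *: e t) -> projective_module P.
Proof.
move=> eP X Y _ _ f g fsurj.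
have [x xE] := choice (fun t => fsurj (g (e t))).
pose h z := \sum_t (c t z : A) *: x t.
have hL : linear h.
  move=> a y z; rewrite /h scaler_sumr -big_split /=; apply: eq_bigr => t _.
  by rewrite linearP scalerDl scalerA.
exists (linear_map hL) => z; rewrite /= /h linear_sum [in RHS](eP z) linear_sum.
by apply: eq_bigr => t _; rewrite !linearZ xE.
Qed.

(** The generators give a surjection from a finite free module, and a lift of
the identity along it is a section. *)
Lemma projective_sub_free (P : lmodType A) :
  fin_dim (A^o : lmodType A) -> projective_module P -> fin_dim P ->
  exists k (h : {linear P -> {ffun 'I_k -> A^o}}), injective h.
Proof.
move=> fA pP fP; have [s sP] := fP.
pose f (F : {ffun 'I_(size s) -> A^o}) : P := \sum_i (F i : A) *: s`_i.
have fL : linear f.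
  move=> a y z; rewrite /f scaler_sumr -big_split /=; apply: eq_bigr => t _.
  by rewrite !ffunE scalerDl scalerA.
have idL : linear (@id P) by [].
have [||y|h hE] := pP _ _ _ _ (linear_map fL) (linear_map idL).
- exact: fin_dim_ffun.
- exact: fP.
- have [c ->] := sP y; exists [ffun i => (c i)%:A : A^o].
  by apply: eq_bigr => i _; rewrite ffunE.
by exists (size s), h => x y e; rewrite -[x]hE -[y]hE e.
Qed.

(** K-subspaces and K-linear functionals of an A-module, on which K acts through
scalars [k%:A]. Subspaces are predicates so that a functional can be extended
one vector at a time. *)
Definition K_closed (Y : lmodType A) (D : Y -> Prop) :=
  forall (k : K) x y, D x -> D y -> D (k%:A *: x + y).

Definition K_linear_on (Y : lmodType A) (D : Y -> Prop) (psi : Y -> K) :=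
  forall (k : K) x y, D x -> D y -> psi (k%:A *: x + y) = k * psi x + psi y.


(** The value at the new vector [y0] is free when [y0] lies outside [D]; here it
is taken to be 0. *)
Lemma extend_functional_step (Y : lmodType A) (D : Y -> Prop) psi y0 :
  D 0 -> K_closed D -> K_linear_on D psi ->
  exists2 psi', K_linear_on (fun y => exists k : K, D (y - k%:A *: y0)) psi' &
    forall y, D y -> psi' y = psi y.
Proof.
move=> D0 Dc psiL.
have DZ (k : K) y : D y -> D (k%:A *: y).
  by move=> Dy; rewrite -[_ *: _]addr0; apply: Dc.
have DB y z : D y -> D z -> D (y - z).
  by move=> Dy Dz; have := Dc (-1) _ _ Dz Dy; rewrite !scaleN1r addrC.
have DD y z : D y -> D z -> D (y + z).
  by move=> Dy Dz; have := Dc 1 _ _ Dy Dz; rewrite !scale1r.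
have [Dy0|nDy0] := pselect (D y0).
  have sub y : (exists k : K, D (y - k%:A *: y0)) -> D y.
    by move=> [k Dk]; rewrite -[y](subrK (k%:A *: y0)); apply/DD/DZ.
  by exists psi => // k x y /sub Dx /sub Dy; apply: psiL.
have uniq (k l : K) y : D (y - k%:A *: y0) -> D (y - l%:A *: y0) -> k = l.
  move=> Dk Dl; apply/eqP/negPn/negP; rewrite -subr_eq0 => ne; apply: nDy0.
  have := DB _ _ Dl Dk.
  rewrite opprB addrC addrA subrK -scalerBl -scalerBl => /(DZ (k - l)^-1).
  by rewrite scalerA -scalerAl mul1r scalerA mulVf // !scale1r.
have /choice[kof kP] y : exists l : K,
    (exists k : K, D (y - k%:A *: y0)) -> D (y - l%:A *: y0).
  have [[k Dk]|no] := pselect (exists k : K, D (y - k%:A *: y0)); first by exists k.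
  by exists 0 => /no.
exists (fun y => psi (y - (kof y)%:A *: y0)).
  move=> k x y /kP Dx /kP Dy.
  have e : k%:A *: x + y - (k * kof x + kof y)%:A *: y0 =
    k%:A *: (x - (kof x)%:A *: y0) + (y - (kof y)%:A *: y0).
    rewrite scalerBr addrACA -opprD scalerA scalerDl scalerDl.
    by rewrite -scalerAl mul1r scalerA.
  have De := Dc k _ _ Dx Dy.
  have -> : kof (k%:A *: x + y) = k * kof x + kof y.
    apply: (@uniq _ _ (k%:A *: x + y)); last by rewrite e.
    by apply: kP; exists (k * kof x + kof y); rewrite e.
  by rewrite e psiL.
move=> y Dy; have Dy0 : D (y - (0 : K)%:A *: y0) by rewrite !scale0r subr0.
have -> : kof y = 0 by apply: (@uniq _ _ y _ Dy0); apply: kP; exists 0.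
by rewrite !scale0r subr0.
Qed.

(** Functionals extend from a subspace to a finite dimensional space. This is
what makes the dual of a projective right module injective. *)
Lemma extend_functional (X Y : lmodType A) (f : {linear X -> Y}) phi :
  fin_dim Y -> injective f -> K_linear_on (fun=> True) phi ->
  exists2 psi, K_linear_on (fun=> True) psi & forall x, psi (f x) = phi x.
Proof.
move=> [s sP] fI phiL.
have /choice[g gP] y : exists x, (exists x', f x' = y) -> f x = y.
  have [[x xy]|no] := pselect (exists x, f x = y); first by exists x.
  by exists 0 => /no.
have gf x : g (f x) = x by apply/fI/gP; exists x.
pose D t y := exists x (c : nat -> K), y = f x + \sum_(i < size t) (c i)%:A *: t`_i.
have D0 t : D t 0.
  exists 0, (fun=> 0); rewrite linear0 add0r big1 // => i _; by rewrite !scale0r.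
have Dc t : K_closed (D t).
  move=> k _ _ [x [c ->]] [y [d ->]]; exists (k%:A *: x + y), (fun i => k * c i + d i).
  rewrite linearP scalerDr addrACA scaler_sumr -big_split; congr (_ + _).
  apply: eq_bigr => i _; by rewrite /= scalerA -scalerAl mul1r scalerA !scalerDl.
have Df t x : D t (f x).
  exists x, (fun=> 0); rewrite big1 ?addr0 // => i _; by rewrite !scale0r.
have Dcons y0 t y : D (y0 :: t) y -> exists k : K, D t (y - k%:A *: y0).
  move=> [x [c ->]]; exists (c 0%N), x, (fun i => c i.+1).
  by rewrite big_ord_recl /= addrA addrAC addrK.
have [psi psiL psif] : exists2 psi, K_linear_on (D s) psi &
    forall x, psi (f x) = phi x.
  elim: s {sP} => [|y0 t [psi psiL psif]].
    exists (fun y => phi (g y)) => [k _ _ [x [c ->]] [y [d ->]]|x]; last by rewrite gf.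
    by rewrite !big_ord0 !addr0 -linearP !gf phiL.
  have [psi' psiL' psi'E] := extend_functional_step y0 (D0 t) (@Dc t) psiL.
  exists psi' => [k x y /Dcons Dx /Dcons Dy|x]; first exact: psiL'.
  by rewrite psi'E.
exists psi => // k x y _ _.
have Ds z : D s z.
  have [c ->] := sP z; exists 0, (fun i => oapp c 0 (insub i)).
  by rewrite linear0 add0r; apply: eq_bigr => i _; rewrite valK.
exact: psiL.
Qed.

End ModuleTheory.

(** * Nonzero paths *)

Section NonzeroPaths.
Variables (n : nat) (R : zero_relations n.+1).

(** The first vertex from which a path can reach the last vertex before [d]
without running through a relation. If no relation has its target before [d] it is 0. *)
Definition cutoff (d : nat) : nat := \max_(r in R | (tgt r < d)%N) (src r).+1.

(** The path from [u] to [v] exists and contains no relation: a relation with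
target at most [v] must start before [u]. *)
Definition nonzero_path (u v : nat) := (cutoff v.+1 <= u <= v)%N.

Lemma cutoff_leqP d m :
  reflect (forall r, r \in zrel_set R -> (tgt r < d)%N -> (src r < m)%N)
          (cutoff d <= m)%N.
Proof.
apply: (iffP (bigmax_leqP _ _ _)) => h r; first by move=> rR rd; apply: h; rewrite rR.
by case/andP=> rR rd; exact: h.
Qed.

Lemma zrel_src_tgt r : r \in zrel_set R -> (src r + 2 <= tgt r)%N.
Proof. by move/zrel_length; rewrite /plength; lia. Qed.

Lemma cutoff_mono d d' : (d <= d')%N -> (cutoff d <= cutoff d')%N.
Proof.
move=> le; apply/cutoff_leqP => r rR rd.
by have /cutoff_leqP := leqnn (cutoff d'); apply => //; lia.
Qed.

Lemma cutoff_le d m : (d <= m.+2)%N -> (cutoff d <= m)%N.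
Proof. by move=> le; apply/cutoff_leqP => r /zrel_src_tgt ? ?; lia. Qed.

Lemma cutoff_lt d : (0 < d)%N -> (cutoff d < d)%N.
Proof. by case: d => // d _; rewrite ltnS; apply: cutoff_le; lia. Qed.

Lemma cutoff0 : cutoff 0 = 0%N.
Proof. by apply/eqP; rewrite -leqn0; apply: cutoff_le. Qed.

Lemma nonzero_pathW u v u' v' :
  nonzero_path u v -> (u <= u' <= v')%N -> (v' <= v)%N -> nonzero_path u' v'.
Proof.
rewrite /nonzero_path => /andP[h1 h2] h3 h4.
have := @cutoff_mono v'.+1 v.+1; lia.
Qed.

Lemma nonzero_trivial u : nonzero_path u u.
Proof. by rewrite /nonzero_path leqnn andbT cutoff_le //; lia. Qed.

Lemma zero_pathP (u v : 'I_n.+1) : (u <= v)%N -> ~~ nonzero_path u v ->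
  exists2 r, r \in zrel_set R & (u <= src r)%N && (tgt r <= v)%N.
Proof.
move=> uv nz; apply: contrapT => no; case/negP: nz; rewrite /nonzero_path uv andbT.
apply/cutoff_leqP => r rR rv; rewrite ltnNge; apply/negP => ur.
by apply: no; exists r; rewrite // ur.
Qed.

Lemma zero_zrel (r : qpath n.+1) u v : r \in zrel_set R ->
  (u <= src r)%N -> (tgt r <= v)%N -> ~~ nonzero_path u v.
Proof.
move=> rR ur rv; apply/negP => /andP[/cutoff_leqP/(_ r rR)]; lia.
Qed.

(** The cutoff is 0 or the successor of a source, so it cannot be [a.+1]. *)
Lemma cutoff_not_source (a : 'I_n.+1) d :
  a \notin sources R -> (cutoff d <= a.+1)%N -> (cutoff d <= a)%N.
Proof.
move=> na /cutoff_leqP h; apply/cutoff_leqP => r rR rd.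
have := h r rR rd; rewrite ltnS leq_eqVlt => /orP[/eqP e|//].
by case/negP: na; apply/imsetP; exists r => //; apply: val_inj.
Qed.

(** Extending a nonzero path by one arrow can only complete a relation whose
target is the new end point. *)
Lemma nonzero_not_target (a : 'I_n.+1) u b :
  a \notin targets R -> nonzero_path u b -> a = b.+1 :> nat -> nonzero_path u a.
Proof.
move=> na /andP[/cutoff_leqP h le] e.
rewrite /nonzero_path; apply/andP; split; last by lia.
apply/cutoff_leqP => r rR; rewrite ltnS leq_eqVlt => /orP[/eqP e'|ra].
  by case/negP: na; apply/imsetP; exists r => //; apply: val_inj.
by apply: h => //; rewrite -e.
Qed.

End NonzeroPaths.

(** * Coordinates in the path algebra and in its quotient *)

Section PathCoefficients.
Variables (K : fieldType) (n : nat).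
Local Notation N := n.+1.
Local Notation KQ := (path_algebra K N).

Definition path_of (u v : 'I_N) (uv : (u <= v)%N) : qpath N := exist _ (u, v) uv.

(** The coefficients of an element as an upper triangular matrix, the zero below
the diagonal standing for the absence of paths. In this form multiplication is
the matrix product, with the factors in the opposite order. *)
Definition kq_coef (x : KQ) (u v : 'I_N) : K :=
  if insub (u, v) is Some p then x p else 0.

Lemma kq_coef_path x p : kq_coef x (src p) (tgt p) = x p.
Proof. by rewrite /kq_coef /src /tgt -surjective_pairing valK. Qed.

Lemma kq_coef_gt x (u v : 'I_N) : (v < u)%N -> kq_coef x u v = 0.
Proof. by move=> vu; rewrite /kq_coef insubN //= -ltnNge. Qed.

Lemma kq_coefD x y (u v : 'I_N) : kq_coef (x + y) u v = kq_coef x u v + kq_coef y u v.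
Proof. by rewrite /kq_coef; case: insubP => [p _ _|_]; rewrite ?ffunE ?addr0. Qed.

Lemma kq_coefZ k x (u v : 'I_N) : kq_coef (k *: x) u v = k * kq_coef x u v.
Proof. by rewrite /kq_coef; case: insubP => [p _ _|_]; rewrite ?ffunE ?mulr0. Qed.

Lemma kq_coef0 (u v : 'I_N) : kq_coef 0 u v = 0.
Proof. by rewrite /kq_coef; case: insubP => [p _ _|_]; rewrite ?ffunE. Qed.

Lemma kq_coef_ffun (F : 'I_N -> 'I_N -> K) (u v : 'I_N) :
  kq_coef [ffun p => F (src p) (tgt p)] u v = if (u <= v)%N then F u v else 0.
Proof.
rewrite /kq_coef; case: insubP => [p /= -> e|/negPf /= -> //].
by rewrite ffunE [src p](congr1 fst e) [tgt p](congr1 snd e).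
Qed.

Lemma kq_coef_elt p (u v : 'I_N) :
  kq_coef (path_elt K p) u v = ((u == src p) && (v == tgt p))%:R.
Proof.
rewrite /kq_coef; case: insubP => [q /= _ e|/= uv].
  by rewrite ffunE -[u](congr1 fst e) -[v](congr1 snd e).
case: andP => // -[/eqP eu /eqP ev]; case/negP: uv.
by rewrite eu ev src_le_tgt.
Qed.

Lemma kq_coef1 (u v : 'I_N) : kq_coef 1 u v = (u == v)%:R.
Proof.
rewrite /kq_coef; case: insubP => [q /= _ e|/= uv].
  by rewrite pa_oneE [src q](congr1 fst e) [tgt q](congr1 snd e).
by case: eqP => // e; rewrite e leqnn in uv.
Qed.

Lemma kq_coefM x y (u w : 'I_N) :
  kq_coef (x * y) u w = \sum_v kq_coef x v w * kq_coef y u v.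
Proof.
have [uw|wu] := leqP u w; last first.
  rewrite kq_coef_gt // big1 // => v _; have [vw|wv] := leqP v w.
    by rewrite (kq_coef_gt y) ?mulr0 // (leq_ltn_trans vw).
  by rewrite kq_coef_gt ?mul0r.
rewrite {1}/kq_coef insubT /= -/(path_of uw); set p := path_of uw.
rewrite ffunE.
have pE : (src p = u) * (tgt p = w) by [].
rewrite (partition_big (fun q => src q) xpredT) //=; apply: eq_bigr => v _.
have [/andP[uv vw]|] := boolP ((u <= v) && (v <= w))%N; last first.
  rewrite negb_and -!ltnNge => out; rewrite big1 => [|q /eqP qv].
    by case/orP: out => lt; rewrite (kq_coef_gt _ lt) ?mul0r ?mulr0.
  rewrite big1 // => r /pcompP[e1 e2 e3].
  have := src_le_tgt q; have := src_le_tgt r.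
  by rewrite e1 e2 e3 !pE qv; move: out; lia.
pose q := path_of vw; pose r := path_of uv.
rewrite (bigD1 q) //= [X in _ + X]big1 ?addr0; last first.
  move=> q' /andP[/eqP qv ne]; rewrite big1 // => r' /pcompP[e1 e2 e3].
  by case/eqP: ne; apply: qpathP; rewrite ?e3.
rewrite (bigD1 r) /=; last by apply/pcompP.
rewrite big1 ?addr0; last first.
  move=> r' /andP[/pcompP[e1 e2 e3] ne].
  by case/eqP: ne; apply: qpathP.
by rewrite -(kq_coef_path x q) -(kq_coef_path y r).
Qed.

Lemma kq_coef_inj x y : (forall u v, kq_coef x u v = kq_coef y u v) -> x = y.
Proof. by move=> e; apply/ffunP => p; rewrite -!kq_coef_path. Qed.

Lemma path_eltM (p q r : qpath N) :
  Defs.pcomp q p r -> path_elt K q * path_elt K p = path_elt K r.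
Proof.
move=> /pcompP[e1 e2 e3]; apply: kq_coef_inj => u w.
rewrite kq_coefM (bigD1 (src q)) //= big1 => [|v ne].
  rewrite !kq_coef_elt eqxx e1 eqxx e2 e3 addr0 -natrM mulnb andbT.
  by rewrite andbC.
by rewrite kq_coef_elt (negPf ne) mul0r.
Qed.

Lemma kq_sum_elt (x : KQ) : x = \sum_p (x p : K) *: path_elt K p.
Proof.
apply/ffunP => q; rewrite sum_ffunE (bigD1 q) //= big1 => [|p ne].
  by rewrite !ffunE eqxx addr0 /GRing.scale /= mulr1.
by rewrite !ffunE eq_sym (negPf ne) scaler0.
Qed.

End PathCoefficients.

Section BoundCoefficients.
Variables (K : fieldType) (n : nat) (R : zero_relations n.+1).
Local Notation N := n.+1.
Local Notation KQ := (path_algebra K N).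
Local Notation A := (bound_path_algebra K R).

Lemma rel_ideal_kq_coef (x : KQ) (u v : 'I_N) :
  x \in rel_ideal R -> nonzero_path R u v -> kq_coef x u v = 0.
Proof.
move=> /asboolP[s [Rs ->]] nz; elim: s Rs => [|t s IH] Rs.
  by rewrite big_nil kq_coef0.
rewrite big_cons kq_coefD IH ?addr0; last first.
  by move=> t' t's; apply: Rs; rewrite in_cons t's orbT.
have [r rR ->] := Rs t (mem_head _ _).
rewrite kq_coefM big1 // => w _; rewrite kq_coefM mulr_suml big1 // => w' _.
rewrite kq_coef_elt; case: andP => [[/eqP-> /eqP->]|_]; last by rewrite mulr0 mul0r.
have [ur|ru] := leqP u (src r); last by rewrite (kq_coef_gt _ ru) mulr0.
have [rv|vr] := leqP (tgt r) v; last by rewrite (kq_coef_gt _ vr) !mul0r.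
by have := zero_zrel rR ur rv; rewrite nz.
Qed.

(** Each path that contains a relation is a product path * relation * path. *)
Lemma kq_coef_rel_ideal (x : KQ) :
  (forall u v : 'I_N, nonzero_path R u v -> kq_coef x u v = 0) -> x \in rel_ideal R.
Proof.
move=> x0; rewrite [x]kq_sum_elt; apply: rpred_sum => p _.
have [nz|z] := boolP (nonzero_path R (src p) (tgt p)).
  by rewrite -kq_coef_path x0 // scale0r rpred0.
have [r rR /andP[ur rv]] := zero_pathP (src_le_tgt p) z.
rewrite -[path_elt K p]mul1r scalerAl; apply: rel_idealMl.
have sp := leq_trans (src_le_tgt r) rv.
rewrite -(@path_eltM _ _ (path_of ur) (path_of sp)); last exact/pcompP.
rewrite -(@path_eltM _ _ r (path_of rv)); last exact/pcompP.
apply/rel_idealMr/rel_idealMl/asboolP; exists [:: (1, path_elt K r, 1)].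
split=> [t|]; first by rewrite inE => /eqP->; exists r.
by rewrite big_seq1 mul1r mulr1.
Qed.

(** The nonzero paths form a basis of the bound path algebra; [path_coef] gives
the coordinates in it, extended by 0 to all pairs of vertices. The coordinates do
not depend on the representative because elements of the ideal only involve paths
that contain a relation. *)
Definition path_coef (a : A) (u v : 'I_N) : K :=
  if nonzero_path R u v then kq_coef (bpa_repr a) u v else 0.

Definition of_coef (F : 'I_N -> 'I_N -> K) : A :=
  bpa_proj R [ffun p => F (src p) (tgt p)].

Definition path_class (u v : 'I_N) : A :=
  of_coef (fun u' v' => ((u' == u) && (v' == v))%:R).

Lemma path_coef_proj x (u v : 'I_N) :
  path_coef (bpa_proj R x) u v = if nonzero_path R u v then kq_coef x u v else 0.
Proof.
rewrite /path_coef; case: ifP => // nz; apply/eqP; rewrite -subr_eq0; apply/eqP.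
rewrite -mulN1r -kq_coefZ -kq_coefD scaleN1r.
exact: rel_ideal_kq_coef (repr_piB _ _) nz.
Qed.

Lemma path_coef_zero a (u v : 'I_N) : ~~ nonzero_path R u v -> path_coef a u v = 0.
Proof. by rewrite /path_coef => /negPf->. Qed.

Lemma path_coef_gt a (u v : 'I_N) : (v < u)%N -> path_coef a u v = 0.
Proof.
by move=> vu; apply: path_coef_zero; rewrite /nonzero_path (leqNgt u) vu andbF.
Qed.

Lemma path_coef_of_coef F (u v : 'I_N) :
  path_coef (of_coef F) u v = if nonzero_path R u v then F u v else 0.
Proof.
by rewrite path_coef_proj kq_coef_ffun; case: ifP => // /andP[_ ->].
Qed.

Lemma path_coefD a b (u v : 'I_N) :
  path_coef (a + b) u v = path_coef a u v + path_coef b u v.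
Proof.
rewrite -[a]bpa_reprK -[b]bpa_reprK bpa_piD !path_coef_proj kq_coefD.
by case: ifP; rewrite ?addr0.
Qed.

Lemma path_coefZ k a (u v : 'I_N) : path_coef (k *: a) u v = k * path_coef a u v.
Proof.
rewrite -[a]bpa_reprK -linearZ !path_coef_proj kq_coefZ.
by case: ifP; rewrite ?mulr0.
Qed.

Lemma path_coef0 (u v : 'I_N) : path_coef 0 u v = 0.
Proof. by rewrite -(scale0r 0) path_coefZ mul0r. Qed.

Lemma path_coefN a (u v : 'I_N) : path_coef (- a) u v = - path_coef a u v.
Proof. by rewrite -scaleN1r path_coefZ mulN1r. Qed.

Lemma path_coef_sum (T : finType) (F : T -> A) (u v : 'I_N) :
  path_coef (\sum_t F t) u v = \sum_t path_coef (F t) u v.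
Proof.
by elim/big_rec2: _ => [|t x y _ <-]; rewrite ?path_coef0 ?path_coefD.
Qed.

Lemma path_coef1 (u v : 'I_N) : path_coef 1 u v = (u == v)%:R.
Proof.
rewrite path_coef_proj kq_coef1; case: ifP => // nz; case: eqP => // e.
by move: nz; rewrite e nonzero_trivial.
Qed.

(** Every subpath of a nonzero path is nonzero, so the formula of the path
algebra passes to the quotient on the nonzero paths. *)
Lemma path_coefM a b (u w : 'I_N) :
  path_coef (a * b) u w =
  if nonzero_path R u w then \sum_v path_coef a v w * path_coef b u v else 0.
Proof.
rewrite -[a]bpa_reprK -[b]bpa_reprK -[_ * _]rmorphM path_coef_proj kq_coefM.
case: ifP => // nz; apply: eq_bigr => v _; rewrite !path_coef_proj.
have [uv|vu] := leqP u v; last by rewrite (kq_coef_gt _ vu) if_same !mulr0.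
have [vw|wv] := leqP v w; last by rewrite (kq_coef_gt _ wv) if_same !mul0r.
by rewrite !(nonzero_pathW nz) ?uv ?vw ?leqnn.
Qed.

Lemma path_coef_inj a b : (forall u v, path_coef a u v = path_coef b u v) -> a = b.
Proof.
rewrite -[a]bpa_reprK -[b]bpa_reprK => e; apply/bpa_eqP/kq_coef_rel_ideal => u v nz.
have := e u v; rewrite !path_coef_proj nz => {}e.
by rewrite kq_coefD -scaleN1r kq_coefZ mulN1r e subrr.
Qed.

Lemma path_coef_path (u v x y : 'I_N) :
  path_coef (path_class u v) x y = ((x == u) && (y == v) && nonzero_path R u v)%:R.
Proof.
rewrite path_coef_of_coef; case: (x =P u) => [->|_]; last by rewrite if_same.
by case: (y =P v) => [->|_]; rewrite ?if_same //; case: ifP.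
Qed.

Lemma path_class_zero (u v : 'I_N) : ~~ nonzero_path R u v -> path_class u v = 0.
Proof.
move=> z; apply: path_coef_inj => x y.
by rewrite path_coef_path (negPf z) andbF path_coef0.
Qed.

Lemma path_coef_pathM (u v : 'I_N) c (x y : 'I_N) : (u <= v)%N ->
  path_coef (path_class u v * c) x y =
  if (y == v) && nonzero_path R x v then path_coef c x u else 0.
Proof.
move=> uv; rewrite path_coefM; have [->|ne] := eqVneq y v; last first.
  rewrite big1 ?if_same // => w _.
  by rewrite path_coef_path (negPf ne) andbF mul0r.
rewrite /=; case: ifP => // nz.
rewrite (bigD1 u) //= big1 => [|w ne]; last by rewrite path_coef_path (negPf ne) mul0r.
rewrite path_coef_path !eqxx addr0 /=.
have [xu|ux] := leqP x u; last by rewrite path_coef_gt ?mulr0.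
by rewrite (nonzero_pathW nz) ?xu ?uv ?mul1r.
Qed.

Lemma path_classM (u v w : 'I_N) : (u <= v <= w)%N ->
  path_class v w * path_class u v = path_class u w.
Proof.
move=> /andP[uv vw]; apply: path_coef_inj => x y.
rewrite path_coef_pathM // !path_coef_path eqxx andbT.
case: (y =P w) => _ /=; last by rewrite andbF.
case: (x =P u) => [->|_] /=; last by rewrite if_same.
by case: ifP => // nz; rewrite (nonzero_pathW nz) ?leqnn ?uv.
Qed.

Lemma mul_path_class c (t v : 'I_N) : (t <= v)%N ->
  c * path_class t v = \sum_w path_coef c v w *: path_class t w.
Proof.
move=> tv; apply: path_coef_inj => x y; rewrite path_coefM path_coef_sum.
rewrite (bigD1 v) //= big1 => [|w ne]; last first.
  by rewrite path_coef_path (negPf ne) andbF mulr0.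
rewrite (bigD1 y) //= big1 => [|w ne]; last first.
  by rewrite path_coefZ path_coef_path [_ == w]eq_sym (negPf ne) andbF mulr0.
rewrite path_coefZ !path_coef_path !eqxx !andbT !addr0.
case: (x =P t) => [->|_] /=; last by rewrite !mulr0 if_same.
case: ifP => nz; last by rewrite mulr0.
have [vy|yv] := leqP v y; last by rewrite (path_coef_gt _ yv) !mul0r.
by rewrite (nonzero_pathW nz) ?leqnn ?tv.
Qed.

Lemma path_class_mul c (v b : 'I_N) : (v <= b)%N ->
  path_class v b * c = \sum_u path_coef c u v *: path_class u b.
Proof.
move=> vb; apply: path_coef_inj => x y; rewrite path_coef_pathM // path_coef_sum.
rewrite (bigD1 x) //= big1 => [|w ne]; last first.
  by rewrite path_coefZ path_coef_path [_ == w]eq_sym (negPf ne) mulr0.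
rewrite path_coefZ path_coef_path eqxx addr0 /=.
case: eqP => _ //=; last by rewrite mulr0.
by case: ifP; rewrite ?mulr1 ?mulr0.
Qed.

Lemma path_coef_expand a :
  a = \sum_(t : 'I_N * 'I_N) path_coef a t.1 t.2 *: path_class t.1 t.2.
Proof.
apply: path_coef_inj => x y; rewrite path_coef_sum.
rewrite (bigD1 (x, y)) //= big1 => [|[u v] ne].
  rewrite path_coefZ path_coef_path !eqxx addr0 /=.
  by case: (boolP (nonzero_path _ _ _)) => z; rewrite ?mulr1 // mulr0 path_coef_zero.
rewrite path_coefZ path_coef_path /= andbA.
have -> : (x == u) && (y == v) = false.
  by apply/negP => /andP[/eqP ex /eqP ey]; rewrite ex ey eqxx in ne.
by rewrite mulr0.
Qed.

Lemma fin_dim_bound_path_algebra : fin_dim (A^o : lmodType A).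
Proof.
apply: (@fin_dim_family _ A A^o ('I_N * 'I_N)%type (fun t => path_class t.1 t.2)) => a.
exists (fun t => path_coef a t.1 t.2); rewrite [LHS]path_coef_expand.
by apply: eq_bigr => t _; rewrite /GRing.scale /= -[RHS]/(_ * _) -scalerAl mul1r.
Qed.

End BoundCoefficients.

(** * Sums of interval modules *)

Section Intervals.
Variables (K : fieldType) (n : nat) (R : zero_relations n.+1).
Local Notation N := n.+1.
Local Notation A := (bound_path_algebra K R).

Section IntervalModule.
Variables (J : finType) (lo hi : J -> nat).

(** For each [j] the support is the interval of vertices from [lo j] to
[hi j].-1, cut off from below so that all paths inside it are nonzero. With this
cut any pair of functions gives a module, and [lo = 0] gives the longest
interval with the given end, which is an indecomposable injective. *)
Definition in_interval (t : J * 'I_N) : bool :=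
  [&& lo t.1 <= t.2, cutoff R (hi t.1) <= t.2 & t.2 < hi t.1]%N.

(** Direct sum over [j] of the interval modules: one basis vector for each vertex
of each interval, and each path acts as 1 from its source to its target. *)
Definition intervals := {ffun {t | in_interval t} -> K^o}.

HB.instance Definition _ := GRing.Zmodule.on intervals.

(** Coordinates extended by 0 outside the support, so that sums may run over all
vertices. *)
Definition entry (z : intervals) (j : J) (v : 'I_N) : K :=
  if insub (j, v) is Some t then z t else 0.

Definition of_entry (F : J -> 'I_N -> K) : intervals :=
  [ffun t => F (val t).1 (val t).2].

Lemma entry_of_entry F j v :
  entry (of_entry F) j v = if in_interval (j, v) then F j v else 0.
Proof.
rewrite /entry; case: insubP => [t -> e|/negPf-> //].
by rewrite ffunE -[j](congr1 fst e) -[v](congr1 snd e).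
Qed.

Lemma entry_out z j v : ~~ in_interval (j, v) -> entry z j v = 0.
Proof. by move=> out; rewrite /entry insubN. Qed.

Lemma entry_inj y z : (forall j v, entry y j v = entry z j v) -> y = z.
Proof.
move=> e; apply/ffunP => t; have := e (val t).1 (val t).2.
by rewrite /entry -surjective_pairing valK.
Qed.

Lemma entryD y z j v : entry (y + z) j v = entry y j v + entry z j v.
Proof. by rewrite /entry; case: insubP => [t _ _|_]; rewrite ?ffunE ?addr0. Qed.

Definition interval_act (a : A) (z : intervals) : intervals :=
  of_entry (fun j v => \sum_u path_coef a u v * entry z j u).

Lemma entry_act a z j v : entry (interval_act a z) j v =
  if in_interval (j, v) then \sum_u path_coef a u v * entry z j u else 0.
Proof. exact: entry_of_entry. Qed.

Lemma interval_nonzero j (u v : 'I_N) :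
  in_interval (j, u) -> in_interval (j, v) -> (u <= v)%N -> nonzero_path R u v.
Proof.
move=> /and3P[/= _ cu _] /and3P[/= _ _ vh] uv; rewrite /nonzero_path uv andbT.
exact: leq_trans (cutoff_mono R vh) cu.
Qed.

Lemma interval_convex j (u v w : 'I_N) :
  in_interval (j, u) -> in_interval (j, w) -> (u <= v <= w)%N -> in_interval (j, v).
Proof. rewrite /in_interval /=; lia. Qed.

(** A path from [w] to [v] inside the interval is the composite of two paths
only at vertices between [w] and [v], and these lie in the interval. *)
Lemma interval_actA a b z : interval_act a (interval_act b z) = interval_act (a * b) z.
Proof.
apply: entry_inj => j v; rewrite !entry_act; case: ifP => // jv.
under eq_bigr do rewrite entry_act.
transitivity (\sum_u \sum_w path_coef a u v * path_coef b w u * entry z j w).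
  apply: eq_bigr => u _; have [ju|ju] := boolP (in_interval (j, u)).
    by rewrite mulr_sumr; apply: eq_bigr => w _; rewrite mulrA.
  rewrite mulr0 big1 // => w _.
  have [jw|jw] := boolP (in_interval (j, w)); last by rewrite (entry_out _ jw) mulr0.
  have [uv|vu] := leqP u v; last by rewrite (path_coef_gt _ vu) !mul0r.
  have [wu|uw] := leqP w u; last by rewrite (path_coef_gt _ uw) mulr0 mul0r.
  by case/negP: ju; apply: interval_convex jw jv _; rewrite wu uv.
rewrite exchange_big; apply: eq_bigr => w _.
have [jw|jw] := boolP (in_interval (j, w)); last first.
  by rewrite (entry_out _ jw) mulr0 big1 // => u _; rewrite mulr0.
rewrite -mulr_suml; congr (_ * _); rewrite path_coefM.
have [wv|vw] := leqP w v; first by rewrite (interval_nonzero jw jv).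
rewrite big1 ?if_same // => u _; have [uv|vu] := leqP u v.
  by rewrite (path_coef_gt b) ?mulr0 //; lia.
by rewrite (path_coef_gt _ vu) mul0r.
Qed.

Lemma interval_act1 : left_id 1 interval_act.
Proof.
move=> z; apply: entry_inj => j v; rewrite entry_act.
case: ifPn => [jv|/(entry_out z)-> //].
rewrite (bigD1 v) //= big1 => [|u ne]; first by rewrite path_coef1 eqxx mul1r addr0.
by rewrite path_coef1 (negPf ne) mul0r.
Qed.

Lemma interval_actDr : right_distributive interval_act +%R.
Proof.
move=> a y z; apply: entry_inj => j v; rewrite entryD !entry_act.
case: ifP => _; rewrite ?addr0 // -big_split; apply: eq_bigr => u _.
by rewrite entryD mulrDr.
Qed.

Lemma interval_actDl z : {morph interval_act^~ z : a b / a + b}.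
Proof.
move=> a b; apply: entry_inj => j v; rewrite entryD !entry_act.
case: ifP => _; rewrite ?addr0 // -big_split; apply: eq_bigr => u _.
by rewrite path_coefD mulrDl.
Qed.

HB.instance Definition _ := GRing.Zmodule_isLmodule.Build A intervals
  interval_actA interval_act1 interval_actDr interval_actDl.

Lemma entryZ (a : A) (z : intervals) j v : entry (a *: z) j v =
  if in_interval (j, v) then \sum_u path_coef a u v * entry z j u else 0.
Proof. exact: entry_act. Qed.

Lemma entry0 j v : entry 0 j v = 0.
Proof. by apply: (addrI (entry 0 j v)); rewrite -entryD !addr0. Qed.

Lemma entry_sum (T : finType) (F : T -> intervals) j v :
  entry (\sum_t F t) j v = \sum_t entry (F t) j v.
Proof. by elim/big_rec2: _ => [|t x y _ <-]; rewrite ?entry0 ?entryD. Qed.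

Lemma entry_scalar (k : K) (z : intervals) j v :
  entry (k%:A *: z) j v = k * entry z j v.
Proof.
rewrite entryZ; case: ifPn => [_|/(entry_out z)->]; last by rewrite mulr0.
rewrite (bigD1 v) //= big1 => [|u ne].
  by rewrite path_coefZ path_coef1 eqxx mulr1 addr0.
by rewrite path_coefZ path_coef1 (negPf ne) mulr0 mul0r.
Qed.

Definition basis_elt (j : J) (v : 'I_N) : intervals :=
  of_entry (fun j' v' => ((j' == j) && (v' == v))%:R).

Lemma entry_basis j v j' v' :
  entry (basis_elt j v) j' v' = ((j' == j) && (v' == v) && in_interval (j, v))%:R.
Proof.
rewrite entry_of_entry; case: (j' =P j) => [->|_]; last by rewrite if_same.
by case: (v' =P v) => [->|_]; rewrite ?if_same //; case: ifP.
Qed.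

Lemma fin_dim_intervals : fin_dim intervals.
Proof.
apply: (@fin_dim_family _ A intervals (J * 'I_N)%type
  (fun t => basis_elt t.1 t.2)) => z.
exists (fun t => entry z t.1 t.2); apply: entry_inj => j v.
rewrite entry_sum (bigD1 (j, v)) //= big1 => [|[j' v'] ne].
  rewrite entry_scalar entry_basis !eqxx addr0 /=.
  by case: (boolP (in_interval _)) => out; rewrite ?mulr1 // mulr0 entry_out.
rewrite entry_scalar entry_basis /=.
have -> : (j == j') && (v == v') = false.
  by apply/negP => /andP[/eqP ex /eqP ey]; rewrite ex ey eqxx in ne.
by rewrite mulr0.
Qed.

Lemma path_class_entry (v w u : 'I_N) (z : intervals) j :
  entry (path_class K R v w *: z) j u =
  if [&& in_interval (j, w), in_interval (j, v), (v <= w)%N & u == w]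
  then entry z j v else 0.
Proof.
rewrite entryZ; case: ifPn => [ju|ju]; last first.
  by case: (u =P w) ju => [<- /negPf->//|_ _]; rewrite !andbF.
rewrite (bigD1 v) //= big1 => [|x ne]; last by rewrite path_coef_path (negPf ne) mul0r.
rewrite path_coef_path eqxx addr0 /=.
case: (u =P w) ju => [->|_] /= jw; last by rewrite !andbF mul0r.
rewrite jw andbT /=; have [jv|jv] /= := boolP (in_interval (j, v)); last first.
  by rewrite entry_out ?mulr0.
have [vw|wv] := leqP v w; first by rewrite (interval_nonzero jv jw) ?mul1r.
by rewrite /nonzero_path (leqNgt v) wv !andbF mul0r.
Qed.

(** The element of A that carries a generator at the vertex [t] to [z]. *)
Definition from_top (j : J) (t : 'I_N) (z : intervals) : A :=
  \sum_v entry z j v *: path_class K R t v.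

Lemma path_coef_from_top j (t : 'I_N) (z : intervals) (u v : 'I_N) :
  path_coef (from_top j t z) u v =
  if (u == t) && nonzero_path R t v then entry z j v else 0.
Proof.
rewrite path_coef_sum (bigD1 v) //= big1 => [|w ne]; last first.
  by rewrite path_coefZ path_coef_path [_ == w]eq_sym (negPf ne) andbF mulr0.
rewrite path_coefZ path_coef_path eqxx addr0 andbT.
by case: ifP; rewrite ?mulr1 ?mulr0.
Qed.

(** When [t] is the top of the interval, the interval module is generated by
its top vector, and a homomorphism out of it is given by any [x] at vertex [t]
that is killed by the paths leaving the interval. *)
Lemma from_top_linear (M : lmodType A) (j : J) (t : 'I_N) (x : M) :
  (forall v : 'I_N, in_interval (j, v) -> (t <= v)%N) ->
  (forall v, ~~ in_interval (j, v) -> path_class K R t v *: x = 0) ->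
  linear (fun z => from_top j t z *: x).
Proof.
move=> tle x0 a y z; rewrite scalerA -scalerDl.
have -> : a * from_top j t y =
    \sum_w (\sum_v path_coef a v w * entry y j v) *: path_class K R t w.
  rewrite mulr_sumr.
  transitivity (\sum_v \sum_w (path_coef a v w * entry y j v) *: path_class K R t w).
    apply: eq_bigr => v _; have [jv|jv] := boolP (in_interval (j, v)).
      rewrite -scalerAr mul_path_class ?tle // scaler_sumr; apply: eq_bigr => w _.
      by rewrite scalerA mulrC.
    rewrite (entry_out _ jv) scale0r mulr0 big1 // => w _.
    by rewrite mulr0 scale0r.
  by rewrite exchange_big; apply: eq_bigr => w _; rewrite scaler_suml.
rewrite /from_top -big_split !scaler_suml; apply: eq_bigr => w _ /=.
rewrite -!scalerDl entryD entryZ.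
have scA (k : K) (b : A) : (k *: b) *: x = k%:A *: (b *: x).
  by rewrite scalerA -scalerAl mul1r.
by case: ifPn => // /x0 e; rewrite !scA e !scaler0.
Qed.

End IntervalModule.

Definition overlap_map (J : finType) (lo hi lo' hi' : J -> nat)
    (z : intervals lo hi) : intervals lo' hi' := of_entry lo' hi' (entry z).

(** The hypothesis says that a path which joins the two supports stays in their
overlap; the identity on common vertices then commutes with all paths. *)
Lemma overlap_map_linear (J : finType) (lo hi lo' hi' : J -> nat) :
  (forall j (u v : 'I_N), in_interval lo hi (j, u) -> in_interval lo' hi' (j, v) ->
     (u <= v)%N -> in_interval lo hi (j, v) && in_interval lo' hi' (j, u)) ->
  linear (@overlap_map _ lo hi lo' hi').
Proof.
move=> H a y z; apply: entry_inj => j v.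
rewrite entryD entryZ !entry_of_entry; case: ifP => jv'; last by rewrite addr0.
rewrite entryD entryZ; congr (_ + _).
have [jv|jv] := boolP (in_interval _ _ (j, v)).
  apply: eq_bigr => u _; rewrite entry_of_entry.
  have [ju|ju] := boolP (in_interval lo hi (j, u)); last first.
    by rewrite (entry_out _ ju) if_same.
  have [uv|vu] := leqP u v; last by rewrite (path_coef_gt _ vu) !mul0r.
  by have /andP[_ ->] := H _ _ _ ju jv' uv.
rewrite big1 // => u _; rewrite entry_of_entry.
have [ju|ju] := boolP (in_interval lo hi (j, u)); last first.
  by rewrite (entry_out _ ju) if_same mulr0.
have [uv|vu] := leqP u v; last by rewrite (path_coef_gt _ vu) !mul0r.
by have := H _ _ _ ju jv' uv; rewrite (negPf jv).
Qed.

Definition no_lower_bound (J : finType) : J -> nat := fun=> 0%N.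

Lemma in_interval_below (J : finType) (hi : J -> nat) j (v : 'I_N) :
  in_interval (@no_lower_bound J) hi (j, v) = (cutoff R (hi j) <= v < hi j)%N.
Proof. by []. Qed.

(** A homomorphism into the longest interval ending at vertex [b] is the same as
a K-functional on the part at [b]: the coordinate at [v] is recovered by first
moving along the path from [v] to [b]. So extending homomorphisms reduces to
extending functionals. *)
Lemma intervals_injective (J : finType) (hi : J -> nat) :
  (forall j, (hi j <= N)%N) -> injective_module (intervals (@no_lower_bound J) hi).
Proof.
move=> hiN X Y _ fY f g fI; pose b j : 'I_N := inord (hi j).-1.
have bE j v : in_interval (@no_lower_bound J) hi (j, v) -> b j = (hi j).-1 :> nat.
  move=> /andP[_ vh]; rewrite inordK //; have := hiN j; move: vh => /=; lia.
have /choice[psi psiP] j : exists psi : Y -> K, K_linear_on (fun=> True) psi /\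
    forall x, psi (f x) = entry (g x) j (b j).
  have gL : K_linear_on (fun=> True) (fun x => entry (g x) j (b j)).
    by move=> k x y _ _; rewrite linearP entryD entry_scalar.
  by have [psi] := extend_functional fY fI gL; exists psi.
have psiD j x y : psi j (x + y) = psi j x + psi j y.
  by have := (psiP j).1 1 x y I I; rewrite !scale1r mul1r.
have psi0 j : psi j 0 = 0.
  by apply: (addrI (psi j 0)); rewrite -psiD !addr0.
have psiZ j k x : psi j (k%:A *: x) = k * psi j x.
  by have := (psiP j).1 k x 0 I I; rewrite addr0 psi0 addr0.
have psi_sum j (T : finType) (F : T -> Y) : psi j (\sum_t F t) = \sum_t psi j (F t).
  by elim/big_rec2: _ => [|t x y _ <-]; rewrite ?psi0 ?psiD.
pose h y : intervals (@no_lower_bound J) hi :=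
  of_entry _ _ (fun j v => psi j (path_class K R v (b j) *: y)).
have hL : linear h.
  move=> a y z; apply: entry_inj => j v; rewrite entryD entryZ !entry_of_entry.
  case: ifP => jv; last by rewrite addr0.
  have vb : (v <= b j)%N by rewrite (bE _ _ jv); case/andP: jv => /=; lia.
  rewrite scalerDr scalerA path_class_mul // psiD; congr (_ + _).
  rewrite scaler_suml psi_sum; apply: eq_bigr => u _.
  rewrite -[_ *: path_class _ _ _ _]mulr_algl -scalerA psiZ entry_of_entry.
  case: ifPn => // ju.
  have [uv|vu] := leqP u v; last by rewrite (path_coef_gt _ vu) !mul0r.
  rewrite path_class_zero ?scale0r ?psi0 //.
  move: ju (jv); rewrite !in_interval_below /nonzero_path (bE _ _ jv).
  by move=> ju /andP[jv1 jv2]; rewrite prednK; lia.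
exists (linear_map hL) => x; apply: entry_inj => j v /=; rewrite entry_of_entry.
case: ifPn => jv; last by rewrite entry_out.
rewrite -linearZ (psiP j).2 linearZ path_class_entry eqxx jv andbT /=.
have /andP[h1 h2] := jv.
suff -> : in_interval (@no_lower_bound J) hi (j, b j) && (v <= b j)%N by [].
rewrite in_interval_below (bE _ _ jv); move: h1 h2 => /=; lia.
Qed.

(** Each interval has its last vertex as socle, and the socle is in the image as
soon as the image contains a nonempty final part of each nonempty interval. From
a nonzero submodule, pick a vector and a vertex where it lives with that vertex
as late as possible: its part there lies in the socle. *)
Lemma intervals_essential (J : finType) (hi m : J -> nat) (X : lmodType A)
    (f : X -> intervals (@no_lower_bound J) hi) :
  (forall j, (hi j <= N)%N) -> (forall j, (m j < hi j)%N \/ hi j = 0%N) ->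
  (forall z, (forall j (v : 'I_N), (v < m j)%N -> entry z j v = 0) ->
     exists x, f x = z) ->
  essential_image f.
Proof.
move=> hiN mhi fim U [U0 UP] [u uU une0].
have UZ a z : z \in U -> a *: z \in U by move=> zU; rewrite -[_ *: _]addr0 UP.
pose P (v : 'I_N) := `[< exists2 z, z \in U & exists j, entry z j v != 0 >].
have [v0 Pv0] : exists v, P v.
  apply: contrapT => no; case/eqP: une0; apply: entry_inj => j v; rewrite entry0.
  apply/eqP/negPn/negP => ne; apply: no; exists v; apply/asboolP.
  by exists u => //; exists j.
case: (@arg_maxnP _ v0 P (fun v => nat_of_ord v) Pv0) => v /asboolP[z zU [j zne]] vmax.
have [x xE] : exists x, f x = path_class K R v v *: z.
  apply: fim => j' w wm; rewrite path_class_entry leqnn /=.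
  case: ifPn => // /and3P[jv _ /eqP wv]; subst w.
  apply/eqP/negPn/negP => ne; have /and3P[_ cv vh] := jv.
  have [mh|h0] := mhi j'; last by rewrite h0 in vh.
  have vN : (v.+1 < N)%N by have := hiN j'; lia.
  suff /vmax : P (Ordinal vN) by rewrite /= ltnn.
  apply/asboolP.
  exists (path_class K R v (Ordinal vN) *: z); first exact: UZ.
  exists j'; rewrite path_class_entry eqxx jv /= leqnSn andbT.
  rewrite in_interval_below /=; case: ifP => // /negP[]; move: cv vh => /=; lia.
exists x; rewrite xE; first exact: UZ.
apply/eqP => /(congr1 (fun z => entry z j v)).
rewrite entry0 path_class_entry leqnn eqxx.
have jv : in_interval (@no_lower_bound J) hi (j, v).
  by apply: contraNT zne => /(entry_out z)->.
by rewrite jv /=; apply/eqP.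
Qed.

(** The interval [b, h) embeds in the interval [a, h), and the map sending the
top of the former to [x] extends to the latter; [y] is the image of the top. *)
Lemma injective_divisible (I : lmodType A) (a b : 'I_N) (h : nat) (x : I) :
  injective_module I -> (a <= b)%N -> (b < h)%N -> (cutoff R h <= a)%N ->
  (forall v : 'I_N, (h <= v)%N -> path_class K R b v *: x = 0) ->
  exists y, path_class K R a b *: y = path_class K R b b *: x.
Proof.
move=> inj ab bh ca x0.
pose X := intervals (fun _ : unit => b : nat) (fun=> h).
pose Y := intervals (fun _ : unit => a : nat) (fun=> h).
have fL : linear
    (@overlap_map unit (fun=> b : nat) (fun=> h) (fun=> a : nat) (fun=> h)).
  apply: overlap_map_linear => j u v; rewrite /in_interval /=; lia.
have gL := @from_top_linear unit (fun=> b : nat) (fun=> h) I tt b x.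
have {}gL : linear (fun z : X => from_top tt b z *: x).
  apply: gL => v; first by case/and3P.
  rewrite /in_interval /= => out.
  have [/x0//|vh] := leqP h v.
  by rewrite path_class_zero ?scale0r // /nonzero_path; apply: contra out; lia.
have fI : injective (linear_map fL).
  move=> y z /= e; apply: entry_inj => -[] v.
  have [jv|jv] := boolP (in_interval (fun=> b : nat) (fun=> h) (tt, v)); last first.
    by rewrite !(entry_out _ jv).
  have := congr1 (fun z => entry z tt v) e; rewrite !entry_of_entry.
  by case: ifPn => // /negP[]; move: jv; rewrite /in_interval /=; lia.
have [g' g'E] := inj X Y (fin_dim_intervals _ _) (fin_dim_intervals _ _)
  (linear_map fL) (linear_map gL) fI.
exists (g' (basis_elt _ _ tt a)).
have aY : in_interval (fun=> a : nat) (fun=> h) (tt, a) by rewrite /in_interval /=; lia.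
have bY : in_interval (fun=> a : nat) (fun=> h) (tt, b) by rewrite /in_interval /=; lia.
have bX : in_interval (fun=> b : nat) (fun=> h) (tt, b) by rewrite /in_interval /=; lia.
have <- : linear_map gL (basis_elt _ _ tt b) = path_class K R b b *: x.
  congr (_ *: _); rewrite /from_top (bigD1 b) //= big1 => [|v ne].
    by rewrite entry_basis !eqxx bX scale1r addr0.
  by rewrite entry_basis (negPf ne) scale0r.
rewrite -g'E -linearZ; congr (g' _); apply: entry_inj => -[] v.
rewrite path_class_entry [RHS]entry_of_entry !entry_basis !eqxx aY bY bX ab /=.
by case: (v =P b) => [->|_]; rewrite ?bY ?if_same.
Qed.

(** Embed the module in a free one. In A an arrow kills a nonzero combination of
paths ending at [b] only if one of them is completed to a relation by the arrow. *)
Lemma projective_arrow_injective (P : lmodType A) (b b' : 'I_N) (x : P) :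
  b' = b.+1 :> nat -> b' \notin targets R -> projective_module P -> fin_dim P ->
  path_class K R b b' *: x = 0 -> path_class K R b b *: x = 0.
Proof.
move=> bb nt pP fP x0.
have [k [h hI]] := projective_sub_free (fin_dim_bound_path_algebra K R) pP fP.
apply: hI; rewrite linear0 linearZ; apply/ffunP => i; rewrite !ffunE.
have : path_class K R b b' * (h x i : A) = 0.
  by have := congr1 (fun z => h z i) x0; rewrite linearZ linear0 !ffunE.
move=> e; apply: path_coef_inj => u v; rewrite [_ *: _]/(_ * _).
rewrite path_coef_pathM // path_coef0; case: ifP => // /andP[_ nz].
have := congr1 (fun z => path_coef z u b') e.
rewrite /= path_coef0 path_coef_pathM; last by rewrite bb.
by rewrite eqxx (nonzero_not_target nt nz bb).
Qed.

End Intervals.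

(** * The minimal injective resolution of the algebra *)

Section Resolution.
Variables (K : fieldType) (n : nat) (R : zero_relations n.+1).
Local Notation N := n.+1.
Local Notation A := (bound_path_algebra K R).
Local Notation Q := (cutoff R).

(** The projective at [i] has a basis the paths from [i], which end at the
vertices from [i] to [last_reached i]. *)
Definition last_reached (i : 'I_N) : 'I_N :=
  [arg max_(v > i | nonzero_path R i v) (v : nat)].

Lemma last_reachedP (i v : 'I_N) :
  nonzero_path R i v = (i <= v <= last_reached i)%N.
Proof.
rewrite /last_reached; case: arg_maxnP => [|p ip pmax]; first exact: nonzero_trivial.
apply/idP/andP => [iv|[iv vp]]; last by apply: (nonzero_pathW ip); rewrite ?iv ?leqnn.
by split; [case/andP: iv | exact: pmax].
Qed.

Lemma cutoff_last_reached (i : 'I_N) : (Q (last_reached i).+1 <= i)%N.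
Proof.
have : nonzero_path R i (last_reached i).
  by rewrite last_reachedP leqnn andbT; have := last_reachedP i i;
    rewrite nonzero_trivial => /esym/andP[].
by case/andP.
Qed.

Lemma last_reached_ge (i : 'I_N) : (i <= last_reached i)%N.
Proof. by have := last_reachedP i i; rewrite nonzero_trivial => /esym/andP[]. Qed.

(** The pair (h, m) stands for the interval [cutoff h, h), an indecomposable
injective, with a submodule [m, h). The cokernel is [cutoff h, m); if it is not
empty, its injective hull is [cutoff m, m) and the next pair is (m, cutoff h).
The pair (0, 0) stands for the zero module. *)
Definition res_next (s : nat * nat) : nat * nat :=
  if (Q s.1 < s.2)%N then (s.2, Q s.1) else (0%N, 0%N).

(** The projective at [i] is the submodule [i, p] of the interval ending at
p = [last_reached i]. *)
Definition res_state (k : nat) (i : 'I_N) : nat * nat :=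
  iter k res_next ((last_reached i).+1, i : nat).

Definition hull_end k i := (res_state k i).1.
Definition image_start k i := (res_state k i).2.

Lemma res_stateP k i :
  [/\ (Q (hull_end k i) <= image_start k i)%N, (hull_end k i <= N)%N &
      (image_start k i < hull_end k i)%N \/
      hull_end k i = 0%N /\ image_start k i = 0%N].
Proof.
rewrite /hull_end /image_start; elim: k => [|k [h1 h2 h3]] /=.
  split; [exact: cutoff_last_reached|exact: ltn_ord|left].
  by rewrite ltnS last_reached_ge.
rewrite /res_next; case: ifP => /= lt; last by rewrite cutoff0; split=> //; right.
split; [|lia|by left].
by apply: cutoff_mono; case: h3; lia.
Qed.

Lemma res_stateS k i :
  (hull_end k.+1 i = image_start k i /\ image_start k.+1 i = Q (hull_end k i)
     /\ (Q (hull_end k i) < image_start k i)%N) \/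
  (hull_end k.+1 i = 0%N /\ image_start k.+1 i = 0%N
     /\ (Q (hull_end k i) = image_start k i)%N).
Proof.
have [h _ _] := res_stateP k i; move: h.
rewrite /hull_end /image_start [res_state k.+1 i]/(res_next (res_state k i)) /res_next.
case: ifPn => lt le; [by left|right; do 2!split=> //].
by apply/eqP; rewrite eqn_leq le leqNgt.
Qed.

Lemma hull_end_anti k i : (hull_end k.+1 i <= hull_end k i)%N.
Proof.
by have [_ _ h] := res_stateP k i; case: (res_stateS k i) => [[-> _]|[-> _]] //; lia.
Qed.

Definition hull k := intervals K R (@no_lower_bound 'I_N) (hull_end k).

(** The cokernel and its hull share the final vertices of the hull, so projecting
and including is the identity on the common vertices. *)
Definition hull_map k : hull k -> hull k.+1 :=
  @overlap_map K n R 'I_N _ _ _ _.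

Lemma hull_map_linear k : linear (@hull_map k).
Proof.
apply: overlap_map_linear => j u v; rewrite !in_interval_below => ju jv uv.
have h := hull_end_anti k j; have := cutoff_mono R h; lia.
Qed.

Lemma hull_map_eq0 k (z : hull k) :
  hull_map z = 0 <-> (forall j (v : 'I_N), (v < image_start k j)%N -> entry z j v = 0).
Proof.
split=> [z0 j v vm|z0].
  have [jv|/(entry_out z)//] :=
    boolP (in_interval R (@no_lower_bound 'I_N) (hull_end k) (j, v)).
  have := congr1 (fun z => entry z j v) z0; rewrite entry0 entry_of_entry.
  case: ifPn => // /negP[]; move: jv; rewrite !in_interval_below => jv.
  have := cutoff_mono R (hull_end_anti k j).
  by case: (res_stateS k j); lia.
apply: entry_inj => j v; rewrite entry0 entry_of_entry; case: ifP => // jv.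
by apply: z0; move: jv; rewrite in_interval_below; case: (res_stateS k j); lia.
Qed.

Lemma hull_map_image k (z : hull k.+1) :
  (forall j (v : 'I_N), (v < image_start k.+1 j)%N -> entry z j v = 0) <->
  exists y, hull_map y = z.
Proof.
split=> [z0|[y <-] j v vm].
  exists (@overlap_map K n R 'I_N _ _ _ _ z); apply: entry_inj => j v.
  rewrite entry_of_entry; case: ifPn => jv; last by rewrite entry_out.
  rewrite entry_of_entry; case: ifPn => // jv'; apply/esym/z0.
  move: jv jv'; rewrite !in_interval_below; have [_ _] := res_stateP k j.
  by have := hull_end_anti k j; case: (res_stateS k j); lia.
rewrite entry_of_entry; case: ifP => // jv; apply: entry_out.
by rewrite in_interval_below; move: vm; case: (res_stateS k j); lia.
Qed.

Definition augmentation (a : A) : hull 0 := @of_entry K n R 'I_N _ _ (path_coef a).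

Lemma entry_augmentation a i v : entry (augmentation a) i v = path_coef a i v.
Proof.
rewrite entry_of_entry in_interval_below; case: ifPn => // out.
rewrite path_coef_zero //.
rewrite last_reachedP; apply: contra out => /andP[iv vl].
by rewrite (leq_trans (cutoff_last_reached i) iv).
Qed.

Lemma augmentation_linear : linear (augmentation : A^o -> hull 0).
Proof.
move=> a x y; apply: entry_inj => i v.
rewrite entryD entryZ !entry_augmentation path_coefD [_ *: _]/(_ * _) path_coefM.
congr (_ + _); rewrite in_interval_below last_reachedP.
under [in RHS]eq_bigr do rewrite entry_augmentation.
have [iv|vi] := leqP i v; last first.
  rewrite big1 ?if_same // => u _; have [uv|vu] := leqP u v.
    by rewrite (path_coef_gt x) ?mulr0 //; lia.
  by rewrite (path_coef_gt a vu) mul0r.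
by rewrite /= /hull_end /= ltnS (leq_trans (cutoff_last_reached i) iv).
Qed.

Lemma augmentation_inj : injective augmentation.
Proof.
by move=> a b e; apply: path_coef_inj => u v; rewrite -!entry_augmentation e.
Qed.

Lemma augmentation_image (z : hull 0) :
  (forall j (v : 'I_N), (v < image_start 0 j)%N -> entry z j v = 0) <->
  exists a, augmentation a = z.
Proof.
split=> [z0|[a <-] j v vm]; last by rewrite entry_augmentation path_coef_gt.
exists (of_coef R (entry z)); apply: entry_inj => i v.
rewrite entry_augmentation path_coef_of_coef last_reachedP.
case: ifPn => // out; have [vi|iv] := ltnP v i; first by rewrite z0.
by rewrite entry_out // in_interval_below; move: out; rewrite /hull_end /=; lia.
Qed.

Definition regular_resolution : min_inj_resolution (A^o : lmodType A).
Proof.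
apply: (@MinInjResolution _ _ _ hull (linear_map augmentation_linear)
  (fun k => linear_map (@hull_map_linear k))).
- by move=> k; apply: fin_dim_intervals.
- by move=> k; apply: intervals_injective => i; case: (res_stateP k i).
- exact: augmentation_inj.
- by move=> x; apply: iff_trans (hull_map_eq0 x) (augmentation_image x).
- by move=> k x; apply: iff_trans (hull_map_eq0 x) (hull_map_image x).
- apply: (@intervals_essential _ _ _ _ _ (image_start 0)) =>
    [i|i|z /augmentation_image//].
    by case: (res_stateP 0 i).
  by case: (res_stateP 0 i) => _ _ [|[]]; [left|right].
- move=> k; apply: (@intervals_essential _ _ _ _ _ (image_start k.+1)) =>
    [i|i|z /hull_map_image//].
    by case: (res_stateP k.+1 i).
  by case: (res_stateP k.+1 i) => _ _ [|[]]; [left|right].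
Defined.

(** The hull of the projective at [i] is the longest interval ending at
[last_reached i]. No nonzero path leaves that interval from its top [t i], since
such a path would restrict to one from [i] beyond [last_reached i]. So it is the
projective at [t i]. *)
Lemma hull0_projective : projective_module (hull 0).
Proof.
pose t i : 'I_N := inord (Q (hull_end 0 i)).
have tE i : t i = Q (hull_end 0 i) :> nat.
  by rewrite inordK //; apply: leq_ltn_trans (cutoff_last_reached i) _.
have it i : in_interval R (@no_lower_bound 'I_N) (hull_end 0) (i, t i).
  by rewrite in_interval_below tE leqnn cutoff_lt.
have cL i : linear (fun z : hull 0 => from_top i (t i) z : A^o).
  have L : linear (fun z : hull 0 => from_top i (t i) z *: (1 : A^o)).
    apply: from_top_linear => v; rewrite in_interval_below.
      by rewrite tE; case/andP.
    move=> out; rewrite path_class_zero ?scale0r //; apply: contra out => tv.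
    have tv' : (t i <= v)%N by case/andP: tv.
    rewrite -tE tv' /= /hull_end /= ltnS.
    have [iv|vi] := leqP i v; last by rewrite ltnW // (leq_trans vi) ?last_reached_ge.
    have : nonzero_path R i v.
      move: tv; rewrite /nonzero_path iv andbT => /andP[le _].
      by apply: leq_trans le _; rewrite tE cutoff_last_reached.
    by rewrite last_reachedP => /andP[].
  by move=> a y z; have := L a y z; rewrite ![_ *: (1 : A^o)]mulr1.
apply: (@projective_of_dual_basis _ _ _ _ (fun i => linear_map (cL i))
  (fun i => basis_elt K R _ _ i (t i))) => z.
apply: entry_inj => j v; rewrite entry_sum (bigD1 j) //= big1 => [|i ne]; last first.
  rewrite entryZ; case: ifP => // _; rewrite big1 // => u _.
  by rewrite entry_basis [_ == i]eq_sym (negPf ne) mulr0.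
rewrite addr0 entryZ; case: ifPn => [jv|jv]; last by rewrite entry_out.
rewrite (bigD1 (t j)) //= big1 => [|u ne]; last first.
  by rewrite entry_basis (negPf ne) andbF mulr0.
rewrite entry_basis !eqxx it mulr1 addr0 path_coef_from_top eqxx.
by rewrite (interval_nonzero (it j) jv) // tE; case/and3P: jv.
Qed.

End Resolution.

(** * The dominant dimension *)

Section DominantDimension.
Variables (K : fieldType) (n : nat) (R : zero_relations n.+1).
Local Notation N := n.+1.
Local Notation A := (bound_path_algebra K R).

Lemma dom_dim_ge1_regular : dom_dim_ge (A^o : lmodType A) 1.
Proof.
by exists (regular_resolution K R) => -[|//] _; apply: hull0_projective.
Qed.

(** As [a] is not a source, the projective at [b] embeds in the projective at
[a], so the idempotent at [b] becomes a multiple of the arrow in an injective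
module. *)
Lemma augmentation_divisible (I : lmodType A) (aug : {linear A^o -> I}) (a b : 'I_N) :
  injective_module I -> b = a.+1 :> nat -> a \notin sources R ->
  exists y, path_class K R a b *: y = aug (path_class K R b b).
Proof.
move=> inj ba na.
have [||||y yE] := @injective_divisible K n R I a b (last_reached R b).+1 (aug 1) inj.
- by rewrite ba.
- by rewrite ltnS last_reached_ge.
- by apply: cutoff_not_source na _; rewrite -ba cutoff_last_reached.
- move=> v bv; rewrite path_class_zero ?scale0r // last_reachedP; lia.
by exists y; rewrite yE -linearZ; congr (aug _); apply: mulr1.
Qed.

(** The vector [y] of [augmentation_divisible] is not in the image of A, while
its multiple by the arrow from [a] to [b] is. So its class in the cokernel is
nonzero, at vertex [a] and killed by the arrow. This is impossible in a
projective module, because [b] is not a target. *)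
Lemma second_term_not_projective (E : min_inj_resolution (A^o : lmodType A))
    (a b : 'I_N) :
  b = a.+1 :> nat -> a \notin sources R -> b \notin targets R ->
  ~ projective_module (res_term E 1).
Proof.
move=> ba na nb p1.
have [y yE] := augmentation_divisible (res_aug E) (@res_injective _ _ _ E 0) ba na.
have ab : (a <= b)%N by rewrite ba.
have : path_class K R a b *: res_diff E 0 y = 0.
  by rewrite -linearZ yE; apply/res_exact0; exists (path_class K R b b).
move/(projective_arrow_injective ba nb p1 (@res_fin_dim _ _ _ E 1)).
rewrite -linearZ => /res_exact0[c cE].
have : res_aug E (path_class K R a b * c) = res_aug E (path_class K R b b).
  by rewrite -[_ * _]/(_ *: (c : A^o)) linearZ /= cE scalerA path_classM ?yE // leqnn.
move/res_aug_inj/(congr1 (fun x => path_coef x b b)).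
rewrite path_coef_pathM // path_coef_path !eqxx nonzero_trivial /= path_coef_gt ?ba //.
by move/eqP; rewrite eq_sym oner_eq0.
Qed.

(** The class of [y] in the second term spans a copy of the simple at [a], so it
is the multiple of some [z] at [a'] by the arrow from [a'] to [a]. The image of
[z] in the third term is killed by that arrow, so it suffices to see that it is
not zero. Otherwise [z] comes from some [w] in the first term, and [w] times the
arrow differs from [y] by an element of A; moving along the path from [a] to the
target [t] of the relation that starts at [a'] removes [w], and the path from [b]
to [t] would factor through [a]. *)
Lemma third_term_not_projective (E : min_inj_resolution (A^o : lmodType A))
    (a' a b : 'I_N) :
  a = a'.+1 :> nat -> b = a.+1 :> nat ->
  a' \in sources R -> a \notin sources R -> a \notin targets R ->
  ~ projective_module (res_term E 2).
Proof.
move=> aa ba /imsetP[r rR a'E] na nt p2.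
have [y yE] := augmentation_divisible (res_aug E) (@res_injective _ _ _ E 0) ba na.
have ab : (a <= b)%N by rewrite ba.
have a'a : (a' <= a)%N by rewrite aa.
pose x := res_diff E 0 y.
have x0 : path_class K R a b *: x = 0.
  by rewrite -linearZ yE; apply/res_exact0; exists (path_class K R b b).
have [||||z zE] := @injective_divisible K n R _ a' a a.+1 x (@res_injective _ _ _ E 1).
- by [].
- by [].
- by apply: cutoff_le; lia.
- move=> v av; rewrite -(@path_classM K n R a b v) ?ab ?ba //.
  by rewrite -scalerA x0 scaler0.
have : path_class K R a' a *: res_diff E 1 z = 0.
  rewrite -linearZ zE -linearZ; apply/res_exact; by eexists.
move/(projective_arrow_injective aa nt p2 (@res_fin_dim _ _ _ E 2)).
rewrite -linearZ => /res_exact[w wE].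
pose t := tgt r.
have bt : (b <= t)%N by have := zrel_src_tgt rR; rewrite -a'E /t; lia.
have at_ : (a <= t)%N by apply: leq_trans bt.
have : res_diff E 0 (path_class K R a' a *: w - path_class K R a a *: y) = 0.
  rewrite linearB !linearZ /= wE scalerA path_classM ?leqnn ?a'a //.
  by rewrite zE scalerN subrr.
case/res_exact0 => c cE.
(* A relation inside the path from b to t would be strictly inside r. *)
have bnz : nonzero_path R b t.
  apply/negPn/negP => /(zero_pathP bt)[s sR /andP[bs st]].
  have sr : s = r.
    by apply: (zrel_minimal sR rR); rewrite /subpath -a'E st andbT; lia.
  by move: bs; rewrite sr -a'E; lia.
have tz : path_class K R a' t = 0.
  by apply/path_class_zero/(zero_zrel rR); rewrite -?a'E.
have : res_aug E (path_class K R a t * c) = - res_aug E (path_class K R b t).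
  rewrite -[_ * _]/(_ *: (c : A^o)) linearZ /= cE scalerBr !scalerA.
  rewrite !path_classM ?leqnn ?a'a ?at_ // tz scale0r sub0r.
  rewrite -(@path_classM K n R a b t) ?ab ?bt // -scalerA yE -linearZ.
  by congr (- res_aug E _); apply: path_classM; rewrite leqnn.
rewrite -linearN => /res_aug_inj/(congr1 (fun x => path_coef x b t)).
rewrite path_coef_pathM // path_coefN path_coef_path !eqxx bnz /= path_coef_gt ?ba //.
by move/eqP; rewrite eq_sym oppr_eq0 oner_eq0.
Qed.

End DominantDimension.

Local Close Scope ring_scope.

Theorem proposition4p5 (K : fieldType) (n : nat) (n_ge3 : (3 <= n.+1)%N)
    (R : zero_relations n.+1)
    (R_src : ord0 \in sources R) (R_tgt : ord_max \in targets R) :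
  let A := bound_path_algebra K R in
  ((exists a b : 'I_n.+1,
      [/\ is_immediate_succ a b, a \notin sources R & b \notin targets R]) ->
   dom_dim_eq (A^o)%R 1) /\
  ((exists a : 'I_n.+1, free_vertex R a) -> dom_dim_le (A^o)%R 2).
Proof.
move=> A.
have part1 : (exists a b : 'I_n.+1,
      [/\ is_immediate_succ a b, a \notin sources R & b \notin targets R]) ->
   dom_dim_eq (A^o)%R 1.
  move=> [a [b [/eqP ba na nb]]]; split; first exact: dom_dim_ge1_regular.
  by move=> [E pE]; apply: (second_term_not_projective ba na nb (pE 1 _)).
split=> // -[a /andP[ns nt]].
have a0 : 0 < a.
  rewrite lt0n; apply: contra ns => /eqP a0.
  by rewrite (_ : a = ord0) //; apply: val_inj.
have an : a.+1 < n.+1.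
  rewrite ltnS ltn_neqAle -ltnS ltn_ord andbT; apply: contra nt => /eqP an.
  by rewrite (_ : a = ord_max) //; apply: val_inj.
have a'n : a.-1 < n.+1 by rewrite (leq_ltn_trans (leq_pred _)).
pose a' := Ordinal a'n; pose b := Ordinal an.
have aa : a = a'.+1 :> nat by rewrite /= prednK.
(* If a - 1 is not a source, then (a - 1, a) is a pair as in the first part. *)
have [a's|na's] := boolP (a' \in sources R); last first.
  by exists 1 => //; apply: part1; exists a', a; split=> //; apply/eqP.
have no3 : ~ dom_dim_ge (A^o)%R 3.
  move=> [E pE].
  exact: (@third_term_not_projective K n R E a' a b aa erefl a's ns nt (pE 2 isT)).
have [ge2|no2] := pselect (dom_dim_ge (A^o)%R 2); first by exists 2.
by exists 1 => //; split=> //; apply: dom_dim_ge1_regular.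
Qed.
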